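(* Let $X$ and $Y$ be compact Hausdorff spaces and let $\mathcal B$ be a finite von Neumann algebra. Suppose that $C(Y) \subset C(X)$ is a unital inclusion of $C^*$-algebras and that $C(Y) \subset \mathcal B$ is a unital inclusion. Then the $C(Y)' \cap \mathcal B$-extreme points of $UCP_{C(Y)}(C(X),\mathcal B)$ are exactly the $*$-homomorphisms from $C(X)$ to $\mathcal B$ that fix $C(Y)$ pointwise.
   Context: A von Neumann algebra $\mathcal B$ is finite if there exists a normal faithful center-valued trace $E \colon \mathcal B \to Z(\mathcal B)$. $UCP_{C(Y)}(C(X),\mathcal B)$ denotes the set of unital completely positive maps $\varphi \colon C(X) \to \mathcal B$ with $\varphi(c) = c$ for all $c \in C(Y)$, where $C(Y)$ is regarded as a subalgebra of both $C(X)$ and $\mathcal B$ via the given inclusions. $C(Y)' \cap \mathcal B$ is the relative commutant of $C(Y)$ in $\mathcal B$. For $b \in \mathcal B$ and a map $\varphi \colon C(X) \to \mathcal B$, $b^*\varphi b$ denotes the map $f \mapsto b^*\varphi(f)b$. A proper $C(Y)' \cap \mathcal B$-convex combination of elements of $UCP_{C(Y)}(C(X),\mathcal B)$ is a finite sum $\sum_{i=1}^n b_i^*\varphi_i b_i$ with $\varphi_i \in UCP_{C(Y)}(C(X),\mathcal B)$ and $b_i \in C(Y)' \cap \mathcal B$ invertible such that $\sum_{i=1}^n b_i^*b_i = 1$. An element $\varphi \in UCP_{C(Y)}(C(X),\mathcal B)$ is $C(Y)' \cap \mathcal B$-extreme if, whenever $\varphi = \sum_{i=1}^n b_i^*\varphi_i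 b_i$ is a proper $C(Y)' \cap \mathcal B$-convex combination, there are unitaries $u_i \in C(Y)' \cap \mathcal B$ such that $\varphi_i = u_i^*\varphi u_i$ for $1 \le i \le n$. *)

(* Defs.v *)
From HB Require Import structures.
From mathcomp Require Import all_boot all_order all_algebra.
From mathcomp Require Import complex.
From mathcomp Require Import all_classical all_reals all_analysis.

Set Implicit Arguments.
Unset Strict Implicit.
Unset Printing Implicit Defensive.

Import Order.TTheory GRing.Theory Num.Theory numFieldNormedType.Exports.

Local Open Scope classical_set_scope.
Local Open Scope ring_scope.

(* The sort of R[i] seen as a numFieldType, so that it carries the topology of
   its norm. *)
Notation Cplx R := (Num.NumField.sort (complex (Real.sort R))).

Section ContinuousFunctions.
Variables (R : realType) (X : topologicalType).

Definition cfun_pred : {pred X -> Cplx R} := [pred f | `[< continuous f >]].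

(* C(X), as a subalgebra of the pointwise algebra X -> R[i] *)
Record cfun := CFun { cfun_val :> X -> Cplx R; cfunP : cfun_val \in cfun_pred }.

HB.instance Definition _ := [isSub for cfun_val].
HB.instance Definition _ := [Choice of cfun by <:].

Let cfun_subring : subring_closed cfun_pred.
Proof.
split=> [|f g /asboolP fc /asboolP gc|f g /asboolP fc /asboolP gc];
  apply/asboolP => x.
- exact: cst_continuous.
- by apply: continuousB; [exact: fc|exact: gc].
- by apply: continuousM; [exact: fc|exact: gc].
Qed.

HB.instance Definition _ :=
  GRing.isSubringClosed.Build (X -> Cplx R) cfun_pred cfun_subring.
HB.instance Definition _ := GRing.SubChoice_isSubComPzRing.Build
  (X -> Cplx R) cfun_pred cfun cfun_subring.

Let cfun_subsemimod : subsemimod_closed cfun_pred.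
Proof.
split; first by split; [exact: rpred0|exact: rpredD].
move=> k f /asboolP fc; apply/asboolP => x.
by apply: (@continuousM _ _ (cst k) f x); [exact: cst_continuous|exact: fc].
Qed.

HB.instance Definition _ := GRing.SubZmodule_isSubLmodule.Build
  (complex R) (X -> Cplx R) cfun_pred cfun cfun_subsemimod.

Lemma cfun_star_subproof (f : cfun) : (fun x => (f x)^*) \in cfun_pred.
Proof.
have /asboolP fc := cfunP f; apply/asboolP => x; apply/cvgrPdist_lt => e e0.
have /cvgrPdist_lt/(_ e e0) := fc x; apply: filterS => y.
by rewrite -rmorphB norm_conjC.
Qed.

Definition cfun_star (f : cfun) : cfun := CFun (cfun_star_subproof f).

End ContinuousFunctions.

Record hilbert (R : realType) := Hilbert {
  hspace :> completeNormedModType (complex R);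
  (* sesquilinear: linear in the first argument,
     conjugate-linear in the second one *)
  ip : {dot hspace for Num.conj};
  ip_norm : forall x : hspace, `|x| ^+ 2 = ip x x }.

Section BoundedOperators.
Variables (R : realType) (H : hilbert R).

Definition bop_pred : {pred H -> H} :=
  [pred T : H -> H | `[< linear T /\ continuous T >]].

(* B(H), as a subspace of H -> H, with composition as product *)
Record bop := Bop { bop_val :> H -> H; bopP : bop_val \in bop_pred }.

HB.instance Definition _ := [isSub for bop_val].
HB.instance Definition _ := [Choice of bop by <:].

Let bop_submod : submod_closed bop_pred.
Proof.
split=> [|k S T /asboolP[Sl Sc] /asboolP[Tl Tc]]; apply/asboolP; split.
- by move=> a x y; rewrite /= scaler0 addr0.
- by move=> x; exact: cst_continuous.
- move=> a x y; rewrite !fctE /= Sl Tl !scalerDr !scalerA.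
  by rewrite [a * k]mulrC addrACA.
- move=> x; apply: (@continuousD _ _ _ (fun y => k *: S y) T); last exact: Tc.
  by apply: continuousZr; exact: Sc.
Qed.

HB.instance Definition _ :=
  GRing.isSubmodClosed.Build (complex R) (H -> H) bop_pred bop_submod.
HB.instance Definition _ := [SubChoice_isSubLmodule of bop by <:].

Let id_subproof : id \in bop_pred.
Proof. by apply/asboolP; split=> // x; exact: cvg_id. Qed.

Let comp_subproof (S T : bop) : S \o T \in bop_pred.
Proof.
have [/asboolP[Sl Sc] /asboolP[Tl Tc]] := (bopP S, bopP T).
apply/asboolP; split=> [a x y|x]; first by rewrite /= Tl Sl.
by apply: continuous_comp; [exact: Tc|exact: Sc].
Qed.

Let one := Bop id_subproof.
Let mul (S T : bop) := Bop (comp_subproof S T).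

Let mulA : associative mul. Proof. by move=> S T U; exact: val_inj. Qed.
Let mul1l : left_id one mul. Proof. by move=> S; exact: val_inj. Qed.
Let mul1r : right_id one mul. Proof. by move=> S; exact: val_inj. Qed.
Let mulDl : left_distributive mul +%R.
Proof. by move=> S T U; exact: val_inj. Qed.
Let mulDr : right_distributive mul +%R.
Proof.
move=> S T U; apply: val_inj; apply/funext => x /=.
have /asboolP[Sl _] := bopP S.
by have := Sl 1 (T x) (U x); rewrite !scale1r.
Qed.

HB.instance Definition _ :=
  GRing.Zmodule_isPzRing.Build bop mulA mul1l mul1r mulDl mulDr.

(* The adjoint, which exists and is unique by the Riesz representation theorem;
   0 is a dummy default value. *)
Definition adj (T : bop) : bop :=
  xget 0 [set S : bop | forall x y, ip H (T x) y = ip H x (S y)].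

End BoundedOperators.

Section VonNeumannAlgebras.
Variables (R : realType) (H : hilbert R).
Implicit Types (B D : set (bop H)) (a b s t z : bop H) (E : bop H -> bop H).

Definition positive_op a := forall x, 0 <= ip H (a x) x.

(* positivity in M_n(B(H)) = B(H^n) *)
Definition positive_op_mx n (A : 'M[bop H]_n) :=
  forall v : 'I_n -> H, 0 <= \sum_i \sum_j ip H (A i j (v j)) (v i).

Definition commutant D : set (bop H) := [set a | forall b, D b -> a * b = b * a].

(* a unital *-subalgebra of B(H) equal to its bicommutant *)
Definition von_neumann_algebra B :=
  [/\ B 1,
      forall k a b, B a -> B b -> B (k *: a + b),
      forall a b, B a -> B b -> B (a * b),
      forall a, B a -> B (adj a) &
      commutant (commutant B) = B].

Definition center B := B `&` commutant B.

(* the order on B is that of operators, a <= b iff b - a is positive *)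
Definition is_sup B D s :=
  [/\ B s, forall d, D d -> positive_op (s - d) &
      forall t, B t -> (forall d, D d -> positive_op (t - d)) ->
        positive_op (t - s)].

Definition directed D :=
  D !=set0 /\ forall a b, D a -> D b ->
    exists c, [/\ D c, positive_op (c - a) & positive_op (c - b)].

(* E preserves the suprema of bounded increasing nets of self-adjoint elements
   of B; the nets are given by their (upward directed) ranges *)
Definition normal_on B E := forall D s,
  D `<=` [set a | B a /\ adj a = a] -> directed D -> is_sup B D s ->
  is_sup (center B) (E @` D) (E s).

Definition center_valued_trace B E :=
  [/\ forall a, B a -> center B (E a),
      forall k a b, B a -> B b -> E (k *: a + b) = k *: E a + E b,
      forall a, B a -> positive_op a -> positive_op (E a),
      forall z, center B z -> E z = z &
      forall a b, B a -> B b -> E (a * b) = E (b * a)].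

Definition faithful_on B E := forall a, B a -> E (adj a * a) = 0 -> a = 0.

(* E : B -> Z(B) is represented by a total map on B(H) *)
Definition finite_vna B :=
  exists E, [/\ center_valued_trace B E, normal_on B E & faithful_on B E].

End VonNeumannAlgebras.

(* a *-homomorphism is not required to be unital *)
Definition star_hom (R : realType) (X : topologicalType) (H : hilbert R)
    (B : set (bop H)) (p : cfun R X -> bop H) :=
  [/\ forall f, B (p f), linear p, {morph p : f g / f * g} &
      forall f, p (cfun_star f) = adj (p f)].

Definition unital_inclusion (R : realType) (X : topologicalType) (H : hilbert R)
    (B : set (bop H)) (j : cfun R X -> bop H) :=
  [/\ star_hom B j, j 1 = 1 & injective j].

Definition unital_cfun_inclusion (R : realType) (X Y : topologicalType)
    (j : cfun R Y -> cfun R X) :=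
  [/\ linear j, {morph j : f g / f * g}, {morph j : f / cfun_star f},
      j 1 = 1 & injective j].

Section UCP.
Variables (R : realType) (X Y : topologicalType) (H : hilbert R).

(* the positive elements of the C*-algebra M_n(C(X)) are the G^* G *)
Definition completely_positive (p : cfun R X -> bop H) :=
  forall n (G : 'M[cfun R X]_n),
    positive_op_mx (map_mx p (map_mx (@cfun_star R X) G^T *m G)).

(* iX and iB are the given inclusions of C(Y) *)
Variables (B : set (bop H)).
Variables (iX : cfun R Y -> cfun R X) (iB : cfun R Y -> bop H).

Definition UCP : set (cfun R X -> bop H) :=
  [set p : cfun R X -> bop H |
    [/\ forall f, B (p f), linear p, p 1 = 1, completely_positive p &
        forall c, p (iX c) = iB c]].

Definition rel_commutant : set (bop H) := B `&` commutant (range iB).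

Definition invertible_in (D : set (bop H)) (b : bop H) :=
  D b /\ exists2 c, D c & b * c = 1 /\ c * b = 1.

Definition unitary_in (D : set (bop H)) (u : bop H) :=
  [/\ D u, adj u * u = 1 & u * adj u = 1].

(* p = \sum_i b_i^* q_i b_i *)
Definition proper_combination n (b : 'I_n -> bop H)
    (q : 'I_n -> cfun R X -> bop H) (p : cfun R X -> bop H) :=
  [/\ forall i, UCP (q i), forall i, invertible_in rel_commutant (b i),
      \sum_i adj (b i) * b i = 1 &
      forall f, p f = \sum_i adj (b i) * q i f * b i].

Definition cstar_extreme : set (cfun R X -> bop H) :=
  [set p : cfun R X -> bop H | UCP p /\
    forall n (b : 'I_n -> bop H) (q : 'I_n -> cfun R X -> bop H),
      proper_combination b q p ->
      exists u : 'I_n -> bop H, forall i,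
        unitary_in rel_commutant (u i) /\
        forall f, q i f = adj (u i) * p f * u i].

End UCP.

(* Main.v *)
From HB Require Import structures.
Require Import Defs.
From mathcomp Require Import all_boot all_order all_algebra.
From mathcomp Require Import complex.
From mathcomp Require Import all_classical all_reals all_analysis.
From mathcomp Require Import ring.

(** A star-homomorphism p is extreme for a reason that does not involve the
    trace. If p = sum_i b_i^* q_i b_i, the column of the b_i is an isometry V
    that dilates p to the direct sum q of the q_i. Multiplicativity of p is
    equality in the Schwarz inequality for q along V, which forces
    q_i f * b_i = b_i * p f ([star_hom_intertwines]). Hence b_i^* b_i commutes
    with the range of p, and the unitary in the polar decomposition of the
    invertible b_i carries p to q_i ([star_hom_extreme]).

    Conversely let p be extreme. Any f in C(X) with 0 < f < 1, bounded away from
    0 and 1, splits p into the maps g |-> p (f g) and g |-> p ((1 - f) g). After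
    normalisation by the square roots of T = p f and of 1 - T, these are UCP
    maps that fix C(Y): p is a C(Y)-module map since C(Y) is in its
    multiplicative domain, so T lies in the relative commutant. Extremality
    yields a unitary u with p (f g) = T^(1/2) u^* p g u T^(1/2). At g = f, the
    Schwarz inequality p (f^2) >= T^2 becomes u^* T u >= T. The two sides have
    the same center-valued trace, so they are equal, because the trace is
    faithful ([unitary_conj_ge]); thus p (f^2) = (p f)^2 ([extreme_square]). So f is in
    the multiplicative domain of p, and such f span C(X) together with 1
    ([extreme_star_hom]).

    The analytic input is elementary. Adjoints come from the Riesz theorem. The
    positive square roots are taken of operators T with |1 - T| < 1, where they
    are limits of a contracting iteration ([operator_sqrt]); they commute with
    all that commutes with T, so they stay in the von Neumann algebra by the
    bicommutant property. Complete positivity is used through the positive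
    semidefinite Gram form of [cp_gram_psd], from which the Schwarz inequality
    and the multiplicative domain follow by Cauchy-Schwarz. *)

Set Implicit Arguments.
Unset Strict Implicit.
Unset Printing Implicit Defensive.

Import Order.TTheory GRing.Theory Num.Theory numFieldNormedType.Exports.

Local Open Scope classical_set_scope.
Local Open Scope ring_scope.

(** * Positive semidefinite sesquilinear forms *)
Section PositiveForms.
Variables (R : realType) (V : lmodType (complex R)) (S : V -> V -> complex R).
Hypothesis (Sl : forall a u v w, S (a *: u + v) w = a * S u w + S v w).
Hypothesis (Sr : forall a u v w, S w (a *: u + v) = a^* * S w u + S w v).
Hypothesis (S_ge0 : forall v, 0 <= S v v).

Let Sv a u b v : S (a *: u + b *: v) (a *: u + b *: v) =
  a * a^* * S u u + a * b^* * S u v + b * a^* * S v u + b * b^* * S v v.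
Proof.
have S0l w : S 0 w = 0.
  by have := Sl (-1) 0 0 w; rewrite scaler0 add0r mulN1r addNr.
have S0r w : S w 0 = 0.
  by have := Sr (-1) 0 0 w; rewrite scaler0 add0r rmorphN1 mulN1r addNr.
rewrite -[b *: v]addr0 !(Sl, Sr) !(S0l, S0r); ring.
Qed.

(** The form takes real values at u + v and at i u + v, which fixes the
    imaginary part of S u v + S v u and the real part of S u v - S v u. *)
Lemma psd_form_herm u v : S v u = (S u v)^*.
Proof.
have re1 : S u v + S v u \is Num.real.
  have := Sv 1 u 1 v; rewrite !scale1r rmorph1 !mul1r => e.
  have -> : S u v + S v u = S (u + v) (u + v) - S u u - S v v
    by rewrite e; ring.
  by rewrite !rpredB ?ger0_real.
have re2 : 'i * (S u v - S v u) \is Num.real.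
  have := Sv 'i u 1 v; rewrite !scale1r rmorph1 !mul1r !mulr1 conjCi => e.
  have -> : 'i * (S u v - S v u) =
    S ('i *: u + v) ('i *: u + v) - S u u - S v v.
    rewrite e mulrN -expr2 sqrCi opprK; ring.
  by rewrite !rpredB ?ger0_real.
move/CrealP: re1; rewrite rmorphD /= => re1.
move/CrealP: re2; rewrite rmorphM rmorphB /= conjCi mulNr -mulrN => re2.
have {}re2 : (S u v)^* - (S v u)^* = - (S u v - S v u).
  by apply: (mulfI (neq0Ci (complex R))); rewrite mulrN -re2 mulrN opprK.
have e : (S u v)^* + (S v u)^* - ((S u v)^* - (S v u)^*) = 2 * (S v u)^*
  by ring.
rewrite re1 re2 in e.
have e' : 2 * S u v = 2 * (S v u)^* by rewrite -e; ring.
have -> : S u v = (S v u)^* by apply: (@mulfI _ 2%:R) e'; rewrite pnatr_eq0.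
by rewrite conjCK.
Qed.

(** The form is only semidefinite, since it will be applied to degenerate
    Gram forms; so the case S v v = 0, where one cannot divide, is settled by
    letting the multiple of v subtracted from u be arbitrarily large. *)
Lemma psd_form_cauchy u v : `|S u v| ^+ 2 <= S u u * S v v.
Proof.
set s := S u v; set a := S v v; set c := S u u.
have a0 : 0 <= a by exact: S_ge0.
have ac : a^* = a by apply/CrealP/ger0_real.
have key (t : complex R) : t \is Num.real ->
    0 <= c - 2 * t * `|s| ^+ 2 + t ^+ 2 * `|s| ^+ 2 * a.
  move=> /CrealP tc; have := S_ge0 (1 *: u + (- t * s) *: v).
  rewrite Sv rmorph1 !rmorphM !rmorphN /= tc (psd_form_herm u v) -/s -/c -/a.
  by rewrite normCK; congr (0 <= _); ring.
have [a_eq0|a_neq0] := eqVneq a 0; last first.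
  have a_gt0 : 0 < a by rewrite lt_def a_neq0.
  have := key a^-1 (ger0_real (ltW _)); rewrite invr_gt0 => /(_ a_gt0).
  have -> : c - 2 * a^-1 * `|s| ^+ 2 + a^-1 ^+ 2 * `|s| ^+ 2 * a =
    a^-1 * (c * a - `|s| ^+ 2) by field.
  by rewrite pmulr_rge0 ?invr_gt0// subr_ge0.
rewrite a_eq0 mulr0.
have c0 : 0 <= c by exact: S_ge0.
have [->//|s_neq0] := eqVneq (`|s| ^+ 2) 0.
have s_gt0 : 0 < `|s| ^+ 2 by rewrite lt_def s_neq0 exprn_ge0.
have t_real : (c + 1) / `|s| ^+ 2 \is Num.real.
  by rewrite ger0_real// divr_ge0 ?addr_ge0 ?(ltW s_gt0).
(* The value of t makes the quadratic bound equal to - (c + 2). *)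
have := key _ t_real; rewrite a_eq0 mulr0 addr0.
rewrite -mulrA divfK// (_ : c - _ = - (c + 2)); last by ring.
by rewrite oppr_ge0 => h; have := lt_le_trans (ltr_wpDl c0 (ltr0n _ 2)) h;
  rewrite ltxx.
Qed.

(** A null vector of a semidefinite form is orthogonal to everything; this is
    what turns equality in a Schwarz inequality into an operator identity. *)
Lemma psd_form_eq0 u v : S v v = 0 -> S u v = 0.
Proof.
move=> v0; have := psd_form_cauchy u v; rewrite v0 mulr0 => h.
by apply/eqP; rewrite -normr_eq0 -sqrf_eq0 eq_le h exprn_ge0.
Qed.

End PositiveForms.

(** * Inner products *)
Section Hilbert.
Variables (R : realType) (H : hilbert R).
Implicit Types (x y z : H) (a : complex R).

Local Notation "<< x , y >>" := (ip H x y).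

Lemma ipPl a x y z : <<a *: x + y, z>> = a * <<x, z>> + <<y, z>>.
Proof. exact: linearPl. Qed.
Lemma ipPr a x y z : <<z, a *: x + y>> = a^* * <<z, x>> + <<z, y>>.
Proof. exact: linearPr. Qed.
Lemma ip_ge0 x : 0 <= <<x, x>>.
Proof. by rewrite -ip_norm exprn_ge0. Qed.
Lemma ipC x y : <<y, x>> = <<x, y>>^*.
Proof. exact: psd_form_herm ipPl ipPr ip_ge0 x y. Qed.
Lemma ip_eq0 x : <<x, x>> = 0 -> x = 0.
Proof. by rewrite -ip_norm => /eqP; rewrite sqrf_eq0 normr_eq0 => /eqP. Qed.
Lemma ip_cauchy x y : `|<<x, y>>| <= `|x| * `|y|.
Proof.
rewrite -(@ler_pXn2r _ 2) ?nnegrE ?mulr_ge0// exprMn !ip_norm.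
exact: psd_form_cauchy ipPl ipPr ip_ge0 x y.
Qed.
Lemma ipDl x y z : <<x + y, z>> =
  <<x, z>> + <<y, z>>. Proof. exact: linearDl. Qed.
Lemma ipDr x y z : <<z, x + y>> =
  <<z, x>> + <<z, y>>. Proof. exact: linearDr. Qed.
Lemma ipBl x y z : <<x - y, z>> =
  <<x, z>> - <<y, z>>. Proof. exact: linearBl. Qed.
Lemma ipBr x y z : <<z, x - y>> =
  <<z, x>> - <<z, y>>. Proof. exact: linearBr. Qed.
Lemma ipZl a x z : <<a *: x, z>> = a * <<x, z>>. Proof. exact: linearZl_LR. Qed.
Lemma ipZr a x z : <<z, a *: x>> =
  a^* * <<z, x>>. Proof. exact: linearZr_LR. Qed.
Lemma ip0l x : <<0, x>> = 0. Proof. exact: linear0l. Qed.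
Lemma ip0r x : <<x, 0>> = 0. Proof. exact: linear0r. Qed.
Lemma ipNl x y : <<- x, y>> = - <<x, y>>. Proof. exact: linearNl. Qed.
Lemma ipNr x y : <<x, - y>> = - <<x, y>>. Proof. exact: linearNr. Qed.
Lemma ip_suml I r (P : pred I) (F : I -> H) y :
  <<\sum_(i <- r | P i) F i, y>> = \sum_(i <- r | P i) <<F i, y>>.
Proof. exact: linear_sumlz. Qed.
Lemma ip_sumr I r (P : pred I) (F : I -> H) y :
  <<y, \sum_(i <- r | P i) F i>> = \sum_(i <- r | P i) <<y, F i>>.
Proof. exact: linear_sumr. Qed.
Lemma ip_ext x y : (forall z, <<x, z>> = <<y, z>>) -> x = y.
Proof. by move=> e; apply/eqP; rewrite -subr_eq0; apply/eqP/ip_eq0;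
  rewrite ipBl e subrr. Qed.
Lemma ip_extr x y : (forall z, <<z, x>> = <<z, y>>) -> x = y.
Proof. by move=> e; apply: ip_ext => z; rewrite ipC e -ipC. Qed.

Lemma hnormZ a x : `|a *: x| = `|a| * `|x|.
Proof. exact: normrZ. Qed.

Lemma parallelogram x y :
  `|x - y| ^+ 2 = 2 * `|x| ^+ 2 + 2 * `|y| ^+ 2 - `|x + y| ^+ 2.
Proof. by rewrite !ip_norm !(ipBl, ipBr, ipDl, ipDr); ring. Qed.

End Hilbert.

(** * Geometric convergence with complex bounds *)
Section ComplexScalars.
Variable R : realType.
Implicit Types r e k x y : complex R.

Lemma complex_expr_lt r e : 0 <= r -> r < 1 -> 0 < e ->
  exists N, forall n, (N <= n)%N -> r ^+ n < e.
Proof.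
move=> r0 r1 e0.
have [[s rE] [d eE]] := (complex_realP _ (ger0_real r0),
  complex_realP _ (gtr0_real e0)).
move: r0 r1 e0; rewrite {}rE {}eE ler0c (ltcR s 1) (ltcR 0 d) => s0 s1 d0.
have /cvgrPdist_lt/(_ d d0)[N _ NP] : (GRing.exp s : R^nat) @ \oo --> 0.
  by apply: cvg_expr; rewrite ger0_norm.
exists N => n /NP /=; rewrite sub0r normrN ger0_norm ?exprn_ge0//.
by rewrite -rmorphXn ltcR.
Qed.

(** All limits of vectors and operators below come with an explicit geometric
    rate, so this is how inequalities pass to the limit. *)
Lemma ler_geometric x y k r : 0 <= k -> 0 <= r -> r < 1 ->
  (forall n, x <= y + k * r ^+ n) -> x <= y.
Proof.
move=> k0 r0 r1 xy; apply/ler_addgt0Pr => e e0.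
have k1 : 0 < k + 1 by rewrite ltr_wpDl.
have [N NP] := complex_expr_lt r0 r1 (divr_gt0 e0 k1).
apply: le_trans (xy N) _; rewrite lerD2l.
apply: le_trans (ler_wpM2l k0 (ltW (NP N (leqnn N)))) _.
by rewrite mulrA ler_pdivrMr// mulrC ler_wpM2l ?ltW// ltrDl.
Qed.

(** Norms on a complex space are complex numbers that happen to be nonnegative
    reals, so infima of sets of norms are transported from the real line. *)
Lemma complex_inf (A : set (complex R)) : A !=set0 -> A `<=` [set x | 0 <= x] ->
  exists d, [/\ 0 <= d, forall x, A x -> d <= x &
    forall e, 0 < e -> exists2 x, A x & x < d + e].
Proof.
move=> [a0 Aa0] A0; set D := [set (complex.Re a) | a in A].
have AR a : A a -> a = (complex.Re a)%:C%C.
  by move=> /A0/ger0_real/RRe_real ->.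
have Dlb : lbound D 0 by move=> _ [a Aa <-]; rewrite -ler0c -AR//; exact: A0.
have D_inf : has_inf D by split; [exists (complex.Re a0), a0|exists 0].
exists (inf D)%:C%C; split=> [|x Ax|e e0].
- by rewrite ler0c; apply: lb_le_inf => //; exact: D_inf.1.
- by rewrite (AR x Ax) lecR; apply: ge_inf; [exact: D_inf.2|exists x].
- have [d eE] := complex_realP _ (gtr0_real e0).
  move: e0; rewrite {}eE (ltcR 0 d) => d0.
  have [_ [a Aa <-] ad] := inf_adherent d0 D_inf.
  by exists a => //; rewrite (AR a Aa) -rmorphD ltcR.
Qed.

End ComplexScalars.

Section GeometricLimits.
Variables (R : realType) (V : completeNormedModType (complex R)).

Lemma norm_geometric_eq (x y : V) (k r : complex R) : 0 <= k -> 0 <=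
  r -> r < 1 ->
  (forall n, `|x - y| <= k * r ^+ n) -> x = y.
Proof.
move=> k0 r0 r1 xy; apply/eqP;
  rewrite -subr_eq0 -normr_eq0 eq_le normr_ge0 andbT.
by apply: (ler_geometric k0 r0 r1) => n; rewrite add0r.
Qed.

Lemma geometric_limit (u : nat -> V) (k r : complex R) :
  0 <= k -> 0 <= r -> r < 1 -> (forall n, `|u n.+1 - u n| <= k * r ^+ n) ->
  exists l, forall n, `|u n - l| <= k / (1 - r) * r ^+ n.
Proof.
move=> k0 r0 r1 u_r; have r1' : 0 < 1 - r by rewrite subr_gt0.
have tail n m : `|u (n + m)%N - u n| <= k / (1 - r) * (r ^+ n - r ^+ (n + m)).
  elim: m => [|m IH]; first by rewrite addn0 !subrr normr0 mulr0.
  rewrite addnS -[_ - u n](subrKA (u (n + m)%N)).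
  apply: le_trans (ler_normD _ _) _; apply: le_trans (lerD (u_r _) IH) _.
  rewrite le_eqVlt; apply/orP; left; apply/eqP.
  by rewrite exprS; field; rewrite gt_eqF.
have {}tail n m : `|u (n + m)%N - u n| <= k / (1 - r) * r ^+ n.
  apply: le_trans (tail n m) _; apply: ler_wpM2l.
    by rewrite divr_ge0 // ltW.
  by rewrite gerBl exprn_ge0.
have kr0 : 0 <= k / (1 - r) by rewrite divr_ge0 // ltW.
have u_cvg : cvg (u @ \oo).
  apply/cauchy_cvgP/cauchy_exP => e e0; rewrite /cauchy_ex.
  have kr1 : 0 < k / (1 - r) + 1 by rewrite ltr_wpDl.
  have [N NP] := complex_expr_lt r0 r1 (divr_gt0 e0 kr1).
  exists (u N); exists N => // n /= Nn; rewrite -ball_normE /ball_/= distrC.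
  rewrite -(subnKC Nn); apply: le_lt_trans (tail _ _) _.
  apply: le_lt_trans (ler_wpM2l kr0 (ltW (NP N (leqnn N)))) _.
  by rewrite mulrA ltr_pdivrMr// mulrC ltr_pM2l// ltrDl.
exists (lim (u @ \oo)) => n; apply/ler_addgt0Pr => e e0.
have /cvgrPdist_lt/(_ e e0)[N _ NP] := u_cvg.
rewrite distrC -(subrKA (u (n + N)%N)) (addrC _ e).
apply: le_trans (ler_normD _ _) _; apply: lerD (tail _ _).
by apply/ltW/NP; rewrite /= leq_addl.
Qed.

End GeometricLimits.

(** * The Riesz representation theorem *)
Section Riesz.
Variables (R : realType) (H : hilbert R) (g : H -> complex R) (K : complex R).
Hypothesis (gP : forall a x y, g (a *: x + y) = a * g x + g y).
Hypotheses (K0 : 0 <= K) (g_bd : forall x, `|g x| <= K * `|x|).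

Let g0 : g 0 = 0.
Proof. by have := gP (-1) 0 0; rewrite scaler0 addr0 mulN1r addNr. Qed.
Let gZ a x : g (a *: x) = a * g x.
Proof. by rewrite -[a *: x]addr0 gP g0 addr0. Qed.
Let gB x y : g (x - y) = g x - g y.
Proof. by rewrite addrC -scaleN1r gP mulN1r addrC. Qed.

(** An affine hyperplane contains a vector of least norm. By the parallelogram
    identity, vectors whose squared norms are within 4 ^ - n of the infimum
    form a Cauchy sequence. *)
Lemma riesz_minimizer x1 : g x1 = 1 ->
  exists2 z, g z = 1 & forall x, g x = 1 -> `|z| ^+ 2 <= `|x| ^+ 2.
Proof.
move=> gx1; set A := [set `|x| ^+ 2 | x in [set x | g x = 1]].
have [||d [d0 dA dlim]] := @complex_inf _ A.
- by exists (`|x1| ^+ 2), x1.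
- by move=> _ [x _ <-] /=; exact: exprn_ge0.
have h0 : (0 : complex R) < 2^-1 by rewrite invr_gt0.
have h1 : (2^-1 : complex R) < 1 by rewrite invf_lt1// ltr1n.
(* A tolerance 4 ^ - n on squared norms gives the rate 2 ^ - n on distances. *)
pose e n : complex R := (2^-1 ^+ n) ^+ 2.
have e0 n : 0 < e n by rewrite !exprn_gt0.
have /choice[u uP] n : exists x, g x = 1 /\ `|x| ^+ 2 < d + e n.
  by have [_ [x gx <-] xd] := dlim _ (e0 n); exists x.
have [n|z zP] := @geometric_limit _ _ u 2 (2^-1) (ler0n _ 2) (ltW h0) h1.
  rewrite -(@ler_pXn2r _ 2) ?nnegrE ?mulr_ge0 ?exprn_ge0// ?(ltW h0)//.
  rewrite parallelogram.
  have m : 4 * d <= `|u n.+1 + u n| ^+ 2.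
    have : d <= `|2^-1 *: (u n.+1 + u n)| ^+ 2.
      apply: dA; exists (2^-1 *: (u n.+1 + u n)) => //=.
      rewrite gZ -[u n.+1]scale1r gP (uP n).1 (uP n.+1).1 mul1r.
      by rewrite mulVf// pnatr_eq0.
    rewrite hnormZ exprMn ger0_norm ?(ltW h0)// => h.
    by rewrite -ler_pdivlMl// (_ : 4^-1 = 2^-1 ^+ 2 :> complex R) //; field.
  have m1 := ltW (uP n).2; have m2 := ltW (uP n.+1).2.
  have m3 : e n.+1 <= e n.
    rewrite /e [2^-1 ^+ n.+1]exprS exprMn; apply: ler_piMl;
      first exact: ltW (e0 n).
    by rewrite exprn_ile1// ltW.
  have -> : (2 * 2^-1 ^+ n) ^+ 2 =
    2 * (d + e n) + 2 * (d + e n) - 4 * d :> complex R.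
    by rewrite /e; ring.
  rewrite lerD ?lerN2// lerD// ler_pM2l//.
  by apply: le_trans m2 _; rewrite lerD2l.
have {}zP n : `|u n - z| <= 4 * 2^-1 ^+ n.
  apply: le_trans (zP n) _; rewrite le_eqVlt; apply/orP; left; apply/eqP;
    congr (_ * _).
  by rewrite [X in X - _](splitr 1) mul1r addrK invrK -natrM.
have hn0 n : 0 <= 2^-1 ^+ n :> complex R by rewrite exprn_ge0// ltW.
exists z.
  apply/eqP; rewrite -subr_eq0 -normr_eq0 eq_le normr_ge0 andbT.
  apply: (@ler_geometric _ _ 0 (K * 4) (2^-1) _ (ltW h0) h1);
    first by rewrite mulr_ge0.
  move=> n; rewrite add0r -[X in _ - X](uP n).1 -gB; apply: le_trans (g_bd _) _.
  by rewrite -mulrA ler_wpM2l// distrC; exact: zP.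
move=> x gx; apply: le_trans (dA _ _); last by exists x.
(* With a = |u n| and t = 2 ^ - n, expand (a + 4 t) ^+ 2 and use
   a ^+ 2 <= d + t, 2 a <= d + 2 and t ^+ 2 <= t. *)
apply: (@ler_geometric _ _ _ (25 + 4 * d) (2^-1) _ (ltW h0) h1) => [|n].
  by rewrite addr_ge0// mulr_ge0.
have zu : `|z| <= `|u n| + 4 * 2^-1 ^+ n.
  rewrite -[z in `|z|](subrK (u n)) addrC; apply: le_trans (ler_normD _ _) _.
  by rewrite lerD2l distrC.
apply: (@le_trans _ _ ((`|u n| + 4 * 2^-1 ^+ n) ^+ 2)).
  by rewrite ler_pXn2r ?nnegrE ?addr_ge0 ?mulr_ge0.
have hn1 : (2^-1 ^+ n) ^+ 2 <= 2^-1 ^+ n :> complex R.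
  by rewrite expr2 ler_piMl// exprn_ile1// ltW.
have un2 : `|u n| ^+ 2 <= d + 2^-1 ^+ n by apply: le_trans (ltW (uP n).2) _;
  rewrite lerD2l.
have un1 : 2 * `|u n| <= d + 2.
  have : 0 <= (`|u n| - 1) ^+ 2 by rewrite -realEsqr rpredB// ger0_real.
  rewrite (_ : _ ^+ 2 = `|u n| ^+ 2 + 1 - 2 * `|u n|); last by ring.
  rewrite subr_ge0 => /le_trans; apply; rewrite -[2%:R]/(1 + 1) addrA lerD2r.
  by apply: le_trans un2 _; rewrite lerD2l exprn_ile1// ltW.
rewrite (_ : _ ^+ 2 = `|u n| ^+ 2 + (4 * (2 * `|u n|) * 2^-1 ^+ n +
  16 * (2^-1 ^+ n) ^+ 2)); last by ring.
rewrite (_ : d + _ = d + 2^-1 ^+ n + (4 * (d + 2) * 2^-1 ^+ n +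
  16 * 2^-1 ^+ n)); last by ring.
by rewrite lerD// lerD ?ler_wpM2l ?ler_wpM2r ?ler_wpM2l.
Qed.

(** A vector of least norm in the hyperplane where g is 1 is orthogonal to the
    kernel of g, and g is the inner product with a multiple of it. *)
Theorem riesz_representation : exists z, forall x, g x = ip H x z.
Proof.
have [g_eq0|/existsNP[x1 gx1]] := pselect (forall x, g x = 0).
  by exists 0 => x; rewrite g_eq0 ip0r.
have [|z gz zmin] := @riesz_minimizer ((g x1)^-1 *: x1).
  by rewrite gZ mulVf//; apply/eqP.
have z_ker k : g k = 0 -> ip H k z = 0.
  move=> gk; have [->|k0] := eqVneq k 0; first by rewrite ip0l.
  have kk0 : ip H k k != 0 by apply: contra_neq k0 => /ip_eq0.
  have kkr : (ip H k k)^* = ip H k k by apply/CrealP/ger0_real/ip_ge0.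
  pose t := ip H z k / ip H k k.
  have := zmin (z - t *: k); rewrite gB gZ gk mulr0 subr0 => /(_ gz).
  rewrite !ip_norm !(ipBl, ipBr, ipZl, ipZr) -/(ip H z z).
  have -> : t^* = (ip H z k)^* / ip H k k by rewrite rmorphM fmorphV /= kkr.
  rewrite (ipC z k) -subr_ge0 /t.
  rewrite (_ : _ - _ = - (`|ip H z k| ^+ 2 / ip H k k));
    last by rewrite normCK; field.
  rewrite oppr_ge0 pmulr_lle0 ?invr_gt0 ?lt_def ?kk0 ?ip_ge0// => h.
  suff -> : ip H z k = 0 by rewrite rmorph0.
  by apply/eqP; rewrite -normr_eq0 -sqrf_eq0 eq_le h exprn_ge0.
have zz0 : ip H z z != 0.
  apply/eqP => /ip_eq0 z0; move: gz; rewrite z0 g0 => /eqP.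
  by rewrite eq_sym oner_eq0.
exists ((ip H z z)^-1 *: z) => x.
have /z_ker : g (x - g x *: z) = 0 by rewrite gB gZ gz mulr1 subrr.
rewrite ipBl ipZl => /eqP; rewrite subr_eq0 => /eqP e.
rewrite ipZr e fmorphV /=.
have -> : (ip H z z)^* = ip H z z by apply/CrealP/ger0_real/ip_ge0.
by rewrite mulrCA mulVf// mulr1.
Qed.

End Riesz.

(** * Bounded operators and their adjoints *)
Section BopLinear.
Variables (R : realType) (H : hilbert R).
Lemma bop_is_linear (T : bop H) : linear T.
Proof. by have /asboolP[] := bopP T. Qed.

HB.instance Definition _ (T : bop H) :=
  GRing.isLinear.Build (complex R) H H *:%R (bop_val T)
    (bop_is_linear T).
End BopLinear.

Section Operators.
Variables (R : realType) (H : hilbert R).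
Implicit Types (S T : bop H) (x y z : H) (a k : complex R).

Definition bounded_by k T := forall x, `|T x| <= k * `|x|.

Lemma bop_ext S T : (forall x, S x = T x) -> S = T.
Proof. by move=> e; apply: val_inj; apply: funext. Qed.
Lemma bopE0 x : (0 : bop H) x = 0. Proof. by []. Qed.
Lemma bopE1 x : (1 : bop H) x = x. Proof. by []. Qed.
Lemma bopEM S T x : (S * T) x = S (T x). Proof. by []. Qed.
Lemma bopED S T x : (S + T) x = S x + T x. Proof. by []. Qed.
Lemma bopEN T x : (- T) x = - T x. Proof. by []. Qed.
Lemma bopEB S T x : (S - T) x = S x - T x. Proof. by []. Qed.
Lemma bopEZ a T x : (a *: T) x = a *: T x. Proof. by []. Qed.
Lemma bopE_sum I r (P : pred I) (F : I -> bop H) x :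
  (\sum_(i <- r | P i) F i) x = \sum_(i <- r | P i) F i x.
Proof. by elim/big_rec2 : _ => // i y T _ <-. Qed.
Definition bopE := (bopED, bopEN, bopEM, bopEZ, bopE0, bopE1, bopE_sum).

Lemma bop0r T : T 0 = 0. Proof. exact: linear0. Qed.
Lemma bopNr T x : T (- x) = - T x. Proof. exact: linearN. Qed.
Lemma bopDr T x y : T (x + y) = T x + T y. Proof. exact: linearD. Qed.
Lemma bopZr T a x : T (a *: x) = a *: T x. Proof. exact: linearZ. Qed.

Lemma bop_scaleAl a S T : (a *: S) * T = a *: (S * T).
Proof. exact: bop_ext. Qed.
Lemma bop_scaleAr a S T : S * (a *: T) = a *: (S * T).
Proof. by apply: bop_ext => x; rewrite !bopE linearZ. Qed.

Lemma bop_bounded T : exists2 k, 0 <= k & bounded_by k T.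
Proof.
have /asboolP[_ Tc] := bopP T.
have /linear_boundedP : bounded_near T (nbhs (0 : H)).
  by apply: continuous_linear_bounded; exact: Tc.
move=> [M [Mr MP]]; exists (`|M| + 1); first by rewrite addr_ge0.
apply: MP; apply: (@le_lt_trans _ _ `|M|); first exact: real_ler_norm.
by rewrite ltrDl.
Qed.

(** This is how the operators constructed pointwise below enter B(H). *)
Lemma bounded_bop (f : H -> H) k : linear f -> (forall x, `|f x| <= k * `|x|) ->
  exists T, forall x, T x = f x.
Proof.
move=> fl fk; have fP : f \in @bop_pred R H.
  apply/asboolP; split=> // x.
  pose g : {linear H -> H} :=
    HB.pack f (GRing.isLinear.Build _ _ _ _ f fl).
  apply: (@bounded_linear_continuous _ _ _ g); apply/linear_boundedP.
  exists `|k|; split=> [|M kM y]; first exact: normr_real.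
  apply: le_trans (fk y) _.
  have [->|y0] := eqVneq y 0; first by rewrite normr0 !mulr0.
  have y1 : 0 < `|y| by rewrite normr_gt0.
  have kr : k \is Num.real.
    have : 0 <= k by rewrite -(pmulr_lge0 _ y1); apply: le_trans (fk y);
      exact: normr_ge0.
    exact: ger0_real.
  apply: ler_wpM2r => //; apply: le_trans (ltW kM); exact: real_ler_norm.
by exists (Bop fP).
Qed.

Let le_ip_norm x y : 0 <= ip H x y -> ip H x y <= `|x| * `|y|.
Proof. by move=> h; rewrite -[leLHS]ger0_norm// ip_cauchy. Qed.

(** By the Riesz theorem; this rules out the default value in [adj]. *)
Lemma adj_exists T : exists S, forall x y, ip H (T x) y = ip H x (S y).
Proof.
have [k k0 Tk] := bop_bounded T.
have /choice[S SP] y : exists z, forall x, ip H (T x) y = ip H x z.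
  apply: (@riesz_representation _ _ _ (k * `|y|)).
  - by move=> a u v; rewrite linearP ipPl.
  - by rewrite mulr_ge0.
  - move=> x; apply: le_trans (ip_cauchy _ _) _.
    by rewrite mulrAC ler_wpM2r.
have [||S' S'P] := @bounded_bop S k.
- move=> a u v; apply: ip_extr => x.
  by rewrite -SP !ipPr !SP.
- move=> y; have [->|Sy0] := eqVneq (S y) 0; first by rewrite normr0 mulr_ge0.
  have Sy1 : 0 < `|S y| by rewrite normr_gt0.
  rewrite -(ler_pM2l Sy1) -expr2 ip_norm -SP.
  apply: le_trans (le_ip_norm _) _.
    by rewrite SP; exact: ip_ge0.
  by rewrite mulrA ler_wpM2r// mulrC; exact: Tk.
by exists S' => x y; rewrite S'P SP.
Qed.

Lemma adjP T x y : ip H (T x) y = ip H x (adj T y).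
Proof.
by move: x y; have /(xgetPex 0) := adj_exists T.
Qed.

Lemma adjPr T x y : ip H x (T y) = ip H (adj T x) y.
Proof. by rewrite ipC adjP -ipC. Qed.

Lemma adj_unique S T : (forall x y, ip H (T x) y = ip H x (S y)) -> adj T = S.
Proof. by move=> TS; apply: bop_ext => y; apply: ip_extr => x;
  rewrite -TS adjP. Qed.

Lemma adjointK T : adj (adj T) = T.
Proof. by apply: adj_unique => x y; rewrite -adjPr. Qed.
Lemma adjointM S T : adj (S * T) = adj T * adj S.
Proof. by apply: adj_unique => x y; rewrite !bopE !adjP. Qed.
Lemma adjointD S T : adj (S + T) = adj S + adj T.
Proof. by apply: adj_unique => x y; rewrite !bopE ipDl ipDr !adjP. Qed.
Lemma adjointB S T : adj (S - T) = adj S - adj T.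
Proof. by apply: adj_unique => x y; rewrite !bopE ipBl ipBr !adjP. Qed.
Lemma adjointZ a T : adj (a *: T) = a^* *: adj T.
Proof. by apply: adj_unique => x y; rewrite !bopE ipZl ipZr !adjP conjCK. Qed.
Lemma adjoint1 : adj (1 : bop H) = 1.
Proof. by apply: adj_unique. Qed.
Lemma adjoint0 : adj (0 : bop H) = 0.
Proof. by apply: adj_unique => x y; rewrite ip0l ip0r. Qed.

Lemma ip_adj_norm T x : ip H ((adj T * T) x) x = `|T x| ^+ 2.
Proof. by rewrite bopEM -adjPr -ip_norm. Qed.

Lemma positive_op_adj T : positive_op T -> adj T = T.
Proof.
move=> T0; apply: adj_unique => x y; rewrite [RHS]ipC.
apply: (@psd_form_herm _ _ (fun u v => ip H (T u) v)) => //.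
- by move=> a u v w; rewrite linearP ipPl.
- by move=> a u v w; rewrite ipPr.
Qed.

(** Cauchy-Schwarz for the form given by T, at x and T x. *)
Lemma positive_op_cauchy T x : positive_op T ->
  (`|T x| ^+ 2) ^+ 2 <= ip H (T x) x * ip H (T (T x)) (T x).
Proof.
move=> T0; have := @psd_form_cauchy _ _ (fun u v => ip H (T u) v) _ _ T0
  x (T x).
rewrite /= -ip_norm ger0_norm ?exprn_ge0//; apply.
- by move=> a u v w; rewrite linearP ipPl.
- by move=> a u v w; rewrite ipPr.
Qed.

(** In operator terms, T ^+ 2 <= k *: T: this replaces the square root of T
    in the arguments about faithfulness of the trace. *)
Lemma positive_op_bounded T k : positive_op T -> bounded_by k T ->
  forall x, `|T x| ^+ 2 <= k * ip H (T x) x.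
Proof.
move=> T0 Tk x; have [->|Tx0] := eqVneq `|T x| 0.
  have [->|x0] := eqVneq x 0; first by rewrite ip0r mulr0 expr0n.
  have x1 : 0 < `|x| by rewrite normr_gt0.
  have k0 : 0 <= k by rewrite -(pmulr_lge0 _ x1); apply: le_trans (Tk x).
  by rewrite expr0n mulr_ge0.
have Tx1 : 0 < `|T x| ^+ 2 by rewrite exprn_gt0// lt_def Tx0 normr_ge0.
rewrite -(ler_pM2r Tx1) -expr2; apply: le_trans (positive_op_cauchy x T0) _.
rewrite mulrAC mulrC; apply: ler_wpM2r; first exact: T0.
apply: le_trans (le_ip_norm (T0 _)) _.
by rewrite expr2 mulrA ler_wpM2r.
Qed.

(** The order controls the norm: a positive operator below k has norm at most
    k, again by Cauchy-Schwarz for the form that the operator defines. *)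
Lemma order_bounded T k : positive_op T -> positive_op (k *: (1 : bop H) - T) ->
  bounded_by k T.
Proof.
move=> T0 Tk x.
have Tk' y : ip H (T y) y <= k * `|y| ^+ 2.
  by have := Tk y; rewrite !bopE ipBl ipZl -ip_norm subr_ge0.
have [->|x0] := eqVneq x 0; first by rewrite linear0 !normr0 mulr0.
have x1 : 0 < `|x| ^+ 2 by rewrite exprn_gt0// normr_gt0.
have k0 : 0 <= k by rewrite -(pmulr_lge0 _ x1); apply: le_trans (Tk' x);
  exact: T0.
have [->|Tx0] := eqVneq `|T x| 0; first by rewrite mulr_ge0.
have Tx1 : 0 < `|T x| ^+ 2 by rewrite exprn_gt0// lt_def Tx0 normr_ge0.
rewrite -(@ler_pXn2r _ 2) ?nnegrE ?mulr_ge0// -(ler_pM2r Tx1) -expr2.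
apply: le_trans (positive_op_cauchy x T0) _.
apply: le_trans (ler_pM (T0 _) (T0 _) (Tk' _) (Tk' _)) _.
by rewrite exprMn mulrACA -expr2 mulrA.
Qed.

End Operators.

(** * Inverses and square roots near the identity *)
Section OperatorLimits.
Variables (R : realType) (H : hilbert R).
Implicit Types (A S T L : bop H) (x y z : H) (a k r : complex R).

Lemma bounded_byD S T k r : bounded_by k S -> bounded_by r T ->
  bounded_by (k + r) (S + T).
Proof. by move=> Sk Tr x; rewrite bopE (le_trans (ler_normD _ _))//
  mulrDl lerD. Qed.
Lemma bounded_byN T k : bounded_by k T -> bounded_by k (- T).
Proof. by move=> Tk x; rewrite bopE normrN. Qed.
Lemma bounded_byM S T k r : 0 <= k -> bounded_by k S -> bounded_by r T ->
  bounded_by (k * r) (S * T).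
Proof.
by move=> k0 Sk Tr x; rewrite bopE (le_trans (Sk _))// -mulrA ler_wpM2l.
Qed.
Lemma bounded_byZ T k a : bounded_by k T -> bounded_by (`|a| * k) (a *: T).
Proof. by move=> Tk x; rewrite bopE hnormZ -mulrA ler_wpM2l. Qed.
Lemma bounded_by1 : bounded_by 1 (1 : bop H).
Proof. by move=> x; rewrite bopE mul1r. Qed.
Lemma bounded_by0 : bounded_by 0 (0 : bop H).
Proof. by move=> x; rewrite bopE normr0 mul0r. Qed.
Lemma bounded_byW T k r : k <= r -> bounded_by k T -> bounded_by r T.
Proof. by move=> kr Tk x; rewrite (le_trans (Tk x))// ler_wpM2r. Qed.
Lemma bounded_by_adj T k : 0 <= k -> bounded_by k T -> bounded_by k (adj T).
Proof.
move=> k0 Tk y; have [->|Ty0] := eqVneq `|adj T y| 0; first by rewrite mulr_ge0.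
have Ty1 : 0 < `|adj T y| by rewrite lt_def Ty0 normr_ge0.
rewrite -(ler_pM2l Ty1) -expr2 ip_norm -adjP.
have le_ip : ip H (T (adj T y)) y <= `|T (adj T y)| * `|y|.
  by rewrite -[leLHS]ger0_norm ?ip_cauchy// adjP ip_ge0.
by rewrite (le_trans le_ip)// mulrA ler_wpM2r// mulrC.
Qed.
Lemma bounded_byX T k n : 0 <=
  k -> bounded_by k T -> bounded_by (k ^+ n) (T ^+ n).
Proof.
move=> k0 Tk; elim: n => [|n IH]; first exact: bounded_by1.
by rewrite !exprS; exact: bounded_byM.
Qed.

Lemma bop_geometric_eq S T k r : 0 <= k -> 0 <= r -> r < 1 ->
  (forall n, bounded_by (k * r ^+ n) (S - T)) -> S = T.
Proof.
move=> k0 r0 r1 ST; apply: bop_ext => x.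
apply: (@norm_geometric_eq _ _ _ _ (k * `|x|) r) => // [|n];
  first by rewrite mulr_ge0.
by rewrite mulrAC; exact: ST.
Qed.

Lemma bop_geometric_limit (Z : nat -> bop H) r : 0 <= r -> r < 1 ->
  (forall n, bounded_by (r ^+ n) (Z n.+1 - Z n)) ->
  exists L, forall n, bounded_by ((1 - r)^-1 * r ^+ n) (Z n - L).
Proof.
move=> r0 r1 Zr; have r10 : 0 <= (1 - r)^-1 by rewrite invr_ge0 subr_ge0 ltW.
have /choice[l lP] x : exists l, forall n, `|Z n x - l| <=
  (1 - r)^-1 * r ^+ n * `|x|.
  have [n|l lP] := @geometric_limit _ _ (fun n => Z n x) _ _ (normr_ge0 x) r0
    r1.
    by rewrite mulrC; exact: Zr.
  by exists l => n; rewrite mulrC mulrA; exact: lP.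
have [k k0 Z0k] := bop_bounded (Z 0%N).
have [||L LP] := @bounded_bop _ _ l (k + (1 - r)^-1).
- move=> a x y.
  apply: (@norm_geometric_eq _ _ _ _
    ((1 - r)^-1 * (`|a *: x + y| + (`|a| * `|x| + `|y|))) r) => // [|n].
    by rewrite mulr_ge0 ?addr_ge0 ?mulr_ge0.
  have -> : l (a *: x + y) - (a *: l x + l y) =
      - (Z n (a *: x + y) - l (a *: x + y)) + (a *: (Z n x - l x) +
        (Z n y - l y)).
    by rewrite [Z n _]linearP scalerBr opprB (addrACA (a *: Z n x)) -opprD
      subrKA.
  apply: le_trans (ler_normD _ _) _; rewrite normrN mulrAC mulrDr lerD//.
  apply: le_trans (ler_normD _ _) _; rewrite mulrDr lerD// hnormZ.
  by rewrite mulrCA ler_wpM2l.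
- move=> x; rewrite -[l x]opprK -[- l x](addKr (Z 0%N x)) opprD opprK.
  apply: le_trans (ler_normB _ _) _; rewrite mulrDl lerD//.
  by have := lP x 0%N; rewrite expr0 mulr1.
by exists L => n x; rewrite bopE bopE LP.
Qed.

Lemma geometric_limit_comm (Z : nat -> bop H) L k r S :
  0 <= k -> 0 <= r -> r < 1 -> (forall n, bounded_by (k * r ^+ n) (Z n - L)) ->
  (forall n, S * Z n = Z n * S) -> S * L = L * S.
Proof.
move=> k0 r0 r1 ZL SZ; have [s s0 Ss] := bop_bounded S.
apply: (@bop_geometric_eq _ _ (k * s + s * k) r) => // [|n].
  by rewrite addr_ge0 ?mulr_ge0.
have -> : S * L - L * S = (Z n - L) * S - S * (Z n - L).
  by rewrite mulrBl mulrBr SZ opprB [RHS]addrC subrKA.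
rewrite mulrDl -[s * k * _]mulrA [k * s * _]mulrAC; apply: bounded_byD.
  by apply: bounded_byM; rewrite ?mulr_ge0 ?exprn_ge0.
by apply/bounded_byN/bounded_byM.
Qed.

(** The partial sums of the Neumann series of A converge geometrically. *)
Lemma neumann_inverse A r : 0 <= r -> r < 1 -> bounded_by r A ->
  exists L, (1 - A) * L = 1 /\ L * (1 - A) = 1.
Proof.
move=> r0 r1 Ar; pose Z n : bop H := \sum_(i < n) A ^+ i.
have [n|L LP] := @bop_geometric_limit Z r r0 r1.
  by rewrite /Z big_ord_recr /= addrAC subrr add0r; exact: bounded_byX.
have r10 : 0 <= (1 - r)^-1 by rewrite invr_ge0 subr_ge0 ltW.
have L1 : (1 - A) * L = 1.
  apply: (@bop_geometric_eq _ _ ((1 + r) * (1 - r)^-1 + 1) r) => // [|n].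
    by rewrite addr_ge0 ?mulr_ge0 ?addr_ge0.
  have -> : (1 - A) * L - 1 = - ((1 - A) * (Z n - L)) - A ^+ n.
    have ZX : (1 - A) * Z n = 1 - A ^+ n
      by rewrite -[RHS]opprB subrX1 -mulNr opprB.
    by rewrite (mulrBr (1 - A)) ZX !opprB -addrA (addrAC (A ^+ n)) subrr add0r.
  rewrite mulrDl mul1r; apply: bounded_byD;
    last by apply/bounded_byN/bounded_byX.
  rewrite -mulrA; apply/bounded_byN/bounded_byM => //;
    first by rewrite addr_ge0.
  by apply: bounded_byD; [exact: bounded_by1|exact: bounded_byN].
exists L; split => //; apply: (etrans _ L1); apply/esym.
apply: (geometric_limit_comm r10 r0 r1 LP) => n.
rewrite /Z mulr_sumr mulr_suml; apply: eq_bigr => i _.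
by rewrite mulrBl mulrBr mul1r mulr1 -exprS -exprSr.
Qed.

(** The iteration Y <- (A + Y ^+ 2) / 2 preserves the ball of radius r and is
    r-Lipschitz there, because all iterates commute. Its fixed point L satisfies
    2 L = A + L ^+ 2, that is (1 - L) ^+ 2 = 1 - A. The iterates are polynomials
    in A, so the limit commutes with all that commutes with A. *)
Lemma operator_sqrt A r : 0 <= r -> r < 1 -> bounded_by r A -> adj A = A ->
  exists s, [/\ s * s = 1 - A, adj s = s & forall S, S * A = A * S -> S * s =
    s * S].
Proof.
move=> r0 r1 Ar Aadj; have [Y [Y0 YS]] : exists Y : nat -> bop H,
    Y 0%N = 0 /\ forall n, Y n.+1 = 2^-1 *: (A + Y n * Y n).
  by exists (fun n => iter n (fun T => 2^-1 *: (A + T * T)) 0).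
have h0 : 0 <= 2^-1 :> complex R by rewrite invr_ge0.
have Ycomm S n : S * A = A * S -> S * Y n = Y n * S.
  move=> SA; elim: n => [|n IH]; first by rewrite Y0 mulr0 mul0r.
  by rewrite YS bop_scaleAl bop_scaleAr mulrDl mulrDr SA mulrA IH -!mulrA IH.
have YYcomm m n : Y m * Y n = Y n * Y m by apply/Ycomm/esym/Ycomm.
have Yadj n : adj (Y n) = Y n.
  elim: n => [|n IH]; first by rewrite Y0 adjoint0.
  by rewrite YS adjointZ adjointD adjointM Aadj IH fmorphV rmorph_nat.
have Yr n : bounded_by r (Y n).
  elim: n => [|n IH]; first by rewrite Y0; exact: (bounded_byW r0 bounded_by0).
  have -> : r = `|2^-1| * (r + r).
    by rewrite ger0_norm// -mulr2n -[r *+ 2]mulr_natl mulKf// pnatr_eq0.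
  rewrite YS; apply/bounded_byZ/bounded_byD => //;
    apply: (bounded_byW _ (bounded_byM r0 IH IH)).
  by rewrite ler_piMl// ltW.
have [n|L LP] := @bop_geometric_limit Y r r0 r1.
  elim: n => [|n IH].
    rewrite YS Y0 mulr0 subr0 addr0 expr0;
      apply: (bounded_byW _ (bounded_byZ _ Ar)).
    by rewrite ger0_norm// mulr_ile1// ?invf_le1// ?ler1n// ltW.
  have -> : Y n.+2 - Y n.+1 = 2^-1 *: ((Y n.+1 + Y n) * (Y n.+1 - Y n)).
    rewrite YS (YS n) -scalerBr -YS; congr (_ *: _).
    by rewrite opprD addrACA subrr add0r mulrDl !mulrBr (YYcomm n) subrKA.
  have -> : r ^+ n.+1 = `|2^-1| * ((r + r) * r ^+ n).
    by rewrite ger0_norm// -mulr2n -[r *+ 2]mulr_natl exprS -mulrA mulKf//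
      pnatr_eq0.
  by apply/bounded_byZ/bounded_byM; rewrite ?addr_ge0//; exact: bounded_byD.
have r10 : 0 <= (1 - r)^-1 by rewrite invr_ge0 subr_ge0 ltW.
have Lcomm S : S * A = A * S -> S * L = L * S.
  by move=> SA; apply: (geometric_limit_comm r10 r0 r1 LP) => n; exact: Ycomm.
have [k k0 Lk] := bop_bounded L.
have Lfix : 2 *: L = A + L * L.
  apply: (@bop_geometric_eq _ _ (`|2| * (1 - r)^-1 * r + (r +
    k) * (1 - r)^-1) r) => // [|n].
    by rewrite addr_ge0 ?mulr_ge0 ?addr_ge0.
  have -> : 2 *: L - (A + L * L) =
    - (2 *: (Y n.+1 - L)) + (Y n + L) * (Y n - L).
    rewrite scalerBr YS scalerA mulfV ?pnatr_eq0// scale1r opprB mulrDl !mulrBr.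
    have -> : Y n * L = L * Y n by apply: Lcomm; rewrite -Ycomm.
    by rewrite subrKA !opprD !addrA subrK.
  rewrite mulrDl -[X in X + _]mulrA -exprS -[X in X + _]mulrA -[X in _ +
    X]mulrA; apply: bounded_byD.
    exact/bounded_byN/bounded_byZ.
  by apply: bounded_byM; rewrite ?addr_ge0//; exact: bounded_byD.
exists (1 - L); split.
- rewrite mulrBl !mulrBr !mul1r mulr1 -addrA; congr (_ + _).
  rewrite -(addrK (L * L) A) -Lfix scaler_nat mulr2n.
  by rewrite !opprD opprK addrA.
- rewrite adjointB adjoint1; congr (_ - _);
  apply: (@bop_geometric_eq _ _ ((1 - r)^-1 + (1 - r)^-1) r) => // [|n].
    by rewrite addr_ge0.
  have -> : adj L - L = (Y n - L) - adj (Y n - L) .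
    by rewrite adjointB Yadj opprB [RHS]addrC subrKA.
  rewrite mulrDl; apply: bounded_byD (LP n) _.
  by apply/bounded_byN/bounded_by_adj; rewrite ?mulr_ge0 ?exprn_ge0.
- by move=> S SA; rewrite mulrBr mulrBl mulr1 mul1r Lcomm.
Qed.

End OperatorLimits.

(** * The involution on continuous functions *)
Section ContinuousFunctionStar.
Variables (R : realType) (X : topologicalType).
Implicit Types (f g : cfun R X) (a : complex R).

Lemma cfun_ext f g : (forall x, f x = g x) -> f = g.
Proof. by move=> e; apply: val_inj; apply: funext. Qed.
Lemma cfunE1 x : (1 : cfun R X) x = 1. Proof. by []. Qed.
Lemma cfunE0 x : (0 : cfun R X) x = 0. Proof. by []. Qed.
Lemma cfunED f g x : (f + g) x = f x + g x. Proof. by []. Qed.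
Lemma cfunEN f x : (- f) x = - f x. Proof. by []. Qed.
Lemma cfunEM f g x : (f * g) x = f x * g x. Proof. by []. Qed.
Lemma cfunEZ a f x : (a *: f) x = a * f x. Proof. by []. Qed.
Lemma cfunE_star f x : cfun_star f x = (f x)^*. Proof. by []. Qed.
Definition cfunE := (cfunED, cfunEN, cfunEM, cfunEZ, cfunE1, cfunE0,
  cfunE_star).

Lemma cfun_starK : involutive (@cfun_star R X).
Proof. by move=> f; apply: cfun_ext => x; rewrite !cfunE conjCK. Qed.
Lemma cfun_starM f g : cfun_star (f * g) = cfun_star f * cfun_star g.
Proof. by apply: cfun_ext => x; rewrite !cfunE rmorphM. Qed.
Lemma cfun_starD f g : cfun_star (f + g) = cfun_star f + cfun_star g.
Proof. by apply: cfun_ext => x; rewrite !cfunE rmorphD. Qed.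
Lemma cfun_starZ a f : cfun_star (a *: f) = a^* *: cfun_star f.
Proof. by apply: cfun_ext => x; rewrite !cfunE rmorphM. Qed.
Lemma cfun_star1 : cfun_star (1 : cfun R X) = 1.
Proof. by apply: cfun_ext => x; rewrite !cfunE rmorph1. Qed.
Lemma cfun_scaleAl a f g : (a *: f) * g = a *: (f * g).
Proof. by apply: cfun_ext => x; rewrite !cfunE mulrA. Qed.
Lemma cfun_scaleAr a f g : f * (a *: g) = a *: (f * g).
Proof. by rewrite mulrC cfun_scaleAl mulrC. Qed.
End ContinuousFunctionStar.

(** * Schwarz inequality and multiplicative domain *)
Section CompletelyPositive.
Variables (R : realType) (X : topologicalType) (H : hilbert R).
Variable (p : cfun R X -> bop H).
Hypotheses (p_lin : linear p) (p1 : p 1 = 1) (p_cp : completely_positive p).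
Implicit Types (f g c : cfun R X) (x y : H).

(** Complete positivity for a matrix whose only nonzero row is f. *)
Lemma cp_row n (f : 'I_n.+1 -> cfun R X) (v : 'I_n.+1 -> H) :
  0 <= \sum_i \sum_j ip H (p (cfun_star (f i) * f j) (v j)) (v i).
Proof.
pose G : 'M[cfun R X]_n.+1 := \matrix_(i, j) (if i == ord0 then f j else 0).
have := p_cp G v.
rewrite (eq_bigr (fun i => \sum_j ip H (p (cfun_star (f i) * f j) (v j)) (v
  i)))//.
move=> i _; apply: eq_bigr => j _;
  rewrite !mxE big_ord_recl big1 ?addr0 ?mxE ?eqxx// => k _.
by rewrite !mxE /= mulr0.
Qed.

(** The Stinespring form on the tensors f_i tensor v_i. Its null vectors and its
    symmetry contain all that is needed about completely positive maps, so the
    Stinespring space itself is never built. *)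
Lemma cp_gram_psd n (f : 'I_n.+1 -> cfun R X) :
  let S (v w : 'I_n.+1 -> H) :=
    \sum_i \sum_j ip H (p (cfun_star (f i) * f j) (v j)) (w i) in
  [/\ forall a u v w, S (a *: u + v) w = a * S u w + S v w,
      forall a u v w, S w (a *: u + v) = a^* * S w u + S w v &
      forall v, 0 <= S v v].
Proof.
move=> S; split=> [a u v w|a u v w|v]; last exact: cp_row.
- rewrite /S mulr_sumr -big_split; apply: eq_bigr => i _ /=.
  rewrite mulr_sumr -big_split; apply: eq_bigr => j _ /=.
  by rewrite linearP ipPl.
- rewrite /S mulr_sumr -big_split; apply: eq_bigr => i _ /=.
  rewrite mulr_sumr -big_split; apply: eq_bigr => j _ /=.
  by rewrite ipPr.
Qed.

Lemma cp_star f : p (cfun_star f) = adj (p f).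
Proof.
apply/esym/adj_unique => x y.
have [Sl Sr S0] := cp_gram_psd (tnth [tuple f; 1]).
have := psd_form_herm Sl Sr S0 (tnth [tuple x; 0]) (tnth [tuple 0; y]).
rewrite /= !big_ord_recl !big_ord0 /= !(tnth0, tnthS) /=.
rewrite !(linear0, ip0l, ip0r, add0r, addr0) cfun_star1 mul1r mulr1.
by move=> e; rewrite [RHS]ipC e conjCK.
Qed.

(** The Gram form at the vector f tensor x - 1 tensor p f x. *)
Lemma cp_schwarz f x : `|p f x| ^+ 2 <= ip H (p (cfun_star f * f) x) x.
Proof.
have := cp_row (tnth [tuple f; 1]) (tnth [tuple x; - p f x]).
rewrite !big_ord_recl !big_ord0 /= !(tnth0, tnthS) /= !addr0.
rewrite cfun_star1 mul1r mulr1 mulr1 p1 bopE cp_star linearN !(ipNl,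
  ipNr) -adjPr opprK.
by rewrite addNr addr0 subr_ge0 -ip_norm.
Qed.

(** Equality in the Schwarz inequality at c says that c tensor x and
    1 tensor p c x differ by a null vector of the Stinespring form, which is
    then orthogonal to every f^* tensor y. *)
Lemma multiplicative_domain c : p (cfun_star c * c) = adj (p c) * p c ->
  forall f, p (f * c) = p f * p c.
Proof.
move=> cc f; apply: bop_ext => x; apply: ip_extr => y; rewrite bopE.
have [Sl Sr S0] := cp_gram_psd (tnth [tuple c; 1; cfun_star f]).
(* The null vector c tensor x - 1 tensor p c x, tested against f^* tensor y. *)
set v := tnth [tuple x; - p c x; 0]; set w := tnth [tuple 0; 0; y].
have v0 : \sum_i \sum_j ip H (p (cfun_star (tnth [tuple c; 1; cfun_star f] i) *
    tnth [tuple c; 1; cfun_star f] j) (v j)) (v i) = 0.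
  rewrite !big_ord_recl !big_ord0 /= /v !(tnth0, tnthS) /=.
  rewrite cfun_star1 mul1r !mulr1 p1 cc cp_star !bopE !bopNr !bop0r.
  by rewrite !(ip0l, ip0r, ipNl, ipNr) !addr0 !subr0 opprK subrr addNr !addr0.
have := psd_form_eq0 Sl Sr S0 w v0.
rewrite !big_ord_recl !big_ord0 /= /v /w !(tnth0, tnthS) /= !bop0r.
rewrite !(ip0l, ip0r) !(add0r,
  addr0) cfun_star1 mul1r ipNr -cfun_starM !cp_star mulrC.
by move/eqP; rewrite subr_eq0 -!adjPr => /eqP.
Qed.

End CompletelyPositive.

(** * Square roots in the relative commutant *)
Section RelativeCommutant.
Variables (R : realType) (Y : topologicalType) (H : hilbert R)
  (B : set (bop H)).
Variable (iB : cfun R Y -> bop H).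
Hypotheses (vnB : von_neumann_algebra B) (iB_hom : star_hom B iB).
Implicit Types (a b s t : bop H).
Local Notation D := (rel_commutant B iB).

Lemma rel_commutantP a : D a <-> B a /\ forall c, a * iB c = iB c * a.
Proof.
split=> [[Ba aD]|[Ba ac]]; split=> //.
- by move=> c; apply: aD; exists c.
- by move=> _ [c _ <-].
Qed.

Lemma rel_commutantM a b : D a -> D b -> D (a * b).
Proof.
have [_ _ BM _ _] := vnB.
move=> /rel_commutantP[Ba ac] /rel_commutantP[Bb bc]; apply/rel_commutantP.
by split=> [|c]; [exact: BM|rewrite -mulrA bc mulrA ac mulrA].
Qed.

Lemma rel_commutant_lin k a b : D a -> D b -> D (k *: a + b).
Proof.
have [_ BP _ _ _] := vnB.
move=> /rel_commutantP[Ba ac] /rel_commutantP[Bb bc]; apply/rel_commutantP.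
by split=> [|c]; [exact: BP|rewrite mulrDl mulrDr bop_scaleAl bop_scaleAr ac
  bc].
Qed.

Lemma rel_commutantZ k a : D a -> D (k *: a).
Proof.
move=> Da; have D0 : D 0 by have := rel_commutant_lin (-1) Da Da;
  rewrite scaleN1r addNr.
by rewrite -[k *: a]addr0; exact: rel_commutant_lin.
Qed.

Lemma rel_commutant_adj a : D a -> D (adj a).
Proof.
have [_ _ _ BV _] := vnB; have [_ _ _ iB_star] := iB_hom.
move=> /rel_commutantP[Ba ac]; apply/rel_commutantP; split=> [|c];
  first exact: BV.
by rewrite -[c]cfun_starK iB_star -!adjointM ac.
Qed.

(** Since B is its own bicommutant, anything obtained from a in a way that
    respects commutation stays in the relative commutant. *)
Lemma rel_commutant_bicomm a s : D a ->
  (forall t, t * a = a * t -> t * s = s * t) -> D s.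
Proof.
have [_ _ _ _ BB] := vnB.
move=> /rel_commutantP[Ba ac] as_; apply/rel_commutantP; split=> [|c].
  by rewrite -BB => t tB; apply/esym/as_/tB.
exact/esym/as_/esym/ac.
Qed.

(** Besides the root s, its inverse t is given, as both conjugate the maps. *)
Lemma rel_commutant_sqrt T r : 0 <= r -> r < 1 -> D T -> adj T = T ->
  bounded_by r (1 - T) -> exists s t,
  [/\ D s, D t, adj s = s /\ adj t = t, s * t = 1 /\ t * s = 1 &
    s * s = T /\ forall a, a * T = T * a -> a * t = t * a].
Proof.
move=> r0 r1 DT T_adj Tr.
have [|s [ss s_adj s_comm]] := operator_sqrt r0 r1 Tr.
  by rewrite adjointB adjoint1 T_adj.
have [L] := neumann_inverse r0 r1 Tr.
rewrite opprB addrC subrK in ss *; move=> [TL LT].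
have {}s_comm a : a * T = T * a -> a * s = s * a.
  by move=> aT; apply: s_comm; rewrite mulrBl mulrBr mulr1 mul1r aT.
have L_comm a : a * T = T * a -> a * L = L * a.
  by move=> aT; rewrite -[a * L]mul1r -LT -mulrA (mulrA T) -aT -!mulrA TL mulr1.
have sT : s * T = T * s by rewrite -ss mulrA.
have L_adj : adj L = L.
  have LT' : adj L * T = 1 by rewrite -T_adj -adjointM TL adjoint1.
  by rewrite -[adj L]mulr1 -TL mulrA LT' mul1r.
have Ds : D s by exact: rel_commutant_bicomm DT s_comm.
have DL : D L by exact: rel_commutant_bicomm DT L_comm.
exists s, (s * L); split=> //.
- exact: rel_commutantM.
- by rewrite adjointM L_adj s_adj L_comm.
- by rewrite mulrA ss TL L_comm// -mulrA ss LT.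
- by split=> // a aT; rewrite mulrA s_comm// -!mulrA L_comm.
Qed.

Lemma invertible_bounded_below b c : c * b = 1 -> exists2 d, 0 < d & forall x,
  d * `|x| ^+ 2 <= `|b x| ^+ 2.
Proof.
move=> cb; have [k k0 ck] := bop_bounded c.
have k1 : 0 < k + 1 by rewrite ltr_wpDl.
(* k + 1 instead of k, which may vanish on the zero space. *)
exists ((k + 1) ^- 2) => [|x]; first by rewrite invr_gt0 exprn_gt0.
rewrite ler_pdivrMl ?exprn_gt0//
  -exprMn ler_pXn2r ?nnegrE ?mulr_ge0 ?(ltW k1)//.
by rewrite -[x in `|x|]bopE1 -cb bopE (le_trans (ck _))// ler_wpM2r//
  lerDl ler01.
Qed.

(** The modulus of b. As b is bounded below, e *: (b^* b) is within distance
    r < 1 of the identity when e is small, so that a root exists by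
    [rel_commutant_sqrt]; then it is scaled back. *)
Lemma modulus_sqrt b : invertible_in D b -> exists s t,
  [/\ D s, D t, adj s = s /\ adj t = t, s * t = 1 /\ t * s = 1 &
    s * s = adj b * b /\
    forall a, a * (adj b * b) = adj b * b * a -> a * t = t * a].
Proof.
move=> [Db [c Dc [bc cb]]].
have [d d0 bd] := invertible_bounded_below cb.
have [k k0 bk] := bop_bounded (adj b).
have Dbb : D (adj b * b) by apply: rel_commutantM => //;
  exact: rel_commutant_adj.
(* Small enough for both e k ^+ 2 <= 1 and e d < 1. *)
pose e := (k ^+ 2 + d + 1)^-1.
have e1 : 0 < k ^+ 2 + d + 1
  by rewrite ltr_wpDl// addr_ge0 ?exprn_ge0 ?(ltW d0).
have e0 : 0 < e by rewrite invr_gt0.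
have ek : e * k ^+ 2 <= 1.
  by rewrite mulrC ler_pdivrMr// mul1r -addrA lerDl addr_ge0 ?(ltW d0).
have ed : e * d < 1.
  by rewrite mulrC ltr_pdivrMr// mul1r addrAC ltrDr ltr_wpDl ?exprn_ge0.
have eR : e^* = e by apply/CrealP/gtr0_real.
pose T := e *: (adj b * b); pose r := sqrtC (1 - e * d).
have r2 : r ^+ 2 = 1 - e * d by rewrite sqrtCK.
have r0 : 0 <= r by rewrite sqrtC_ge0 subr_ge0 ltW.
have r1 : r < 1.
  by rewrite -(@ltr_pXn2r _ 2) ?nnegrE// expr1n r2 gtrBl mulr_gt0.
have T_adj : adj T = T by rewrite adjointZ adjointM adjointK eR.
have Tr : bounded_by r (1 - T).
  move=> x; rewrite -(@ler_pXn2r _ 2) ?nnegrE ?mulr_ge0// exprMn r2.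
  have bbx : ip H (adj b (b x)) x = `|b x| ^+ 2 by rewrite -ip_adj_norm.
  have bbx' : ip H x (adj b (b x)) = `|b x| ^+ 2 by rewrite -adjP -ip_norm.
  rewrite ip_norm /T !bopE !(ipBl, ipBr, ipZl, ipZr) eR bbx bbx' -!ip_norm.
  have h : `|adj b (b x)| ^+ 2 <= k ^+ 2 * `|b x| ^+ 2.
    by rewrite -exprMn ler_pXn2r ?nnegrE ?mulr_ge0.
  have h1 : e * (e * `|adj b (b x)| ^+ 2) <= e * `|b x| ^+ 2.
    rewrite ler_pM2l//; apply: le_trans (ler_wpM2l (ltW e0) h) _.
    by rewrite mulrA ler_piMl// exprn_ge0.
  have h2 : e * (d * `|x| ^+ 2) <= e * `|b x| ^+ 2 by rewrite ler_pM2l.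
  rewrite [leLHS](_ : _ = `|x| ^+ 2 - e * `|b x| ^+ 2 +
    (e * (e * `|adj b (b x)| ^+ 2) - e * `|b x| ^+ 2)); last by ring.
  rewrite [leRHS](_ : _ = `|x| ^+ 2 - e * (d * `|x| ^+ 2) + 0); last by ring.
  by rewrite lerD ?lerB ?subr_le0.
have [s [t [Ds Dt [s_adj t_adj] [st ts] [ss t_comm]]]] :=
  rel_commutant_sqrt r0 r1 (rel_commutantZ _ Dbb) T_adj Tr.
pose g := sqrtC e.
have g0 : g != 0 by rewrite sqrtC_eq0 gt_eqF.
have gR : g^* = g by apply/CrealP/ger0_real; rewrite sqrtC_ge0 ltW.
exists (g^-1 *: s), (g *: t); split; try exact: rel_commutantZ.
- by split; rewrite adjointZ ?fmorphV /= gR ?s_adj ?t_adj.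
- by rewrite !bop_scaleAl !bop_scaleAr !scalerA mulVf// mulfV// !scale1r.
- rewrite bop_scaleAl bop_scaleAr scalerA ss scalerA -invfM -expr2 sqrtCK.
  rewrite mulVf ?gt_eqF// scale1r; split=> // a ab.
  by rewrite bop_scaleAl bop_scaleAr t_comm// bop_scaleAl bop_scaleAr ab.
Qed.

End RelativeCommutant.

(** * Homomorphisms are extreme *)
Section StarHomExtreme.
Variables (R : realType) (X : topologicalType) (H : hilbert R)
  (B : set (bop H)).
Variable (p : cfun R X -> bop H).
Hypothesis (p_hom : star_hom B p).

Lemma linear_sum_fun (V W : lmodType (complex R)) (g : V -> W) (gl : linear g)
  I r (P : pred I) (F : I -> V) :
  g (\sum_(i <- r | P i) F i) = \sum_(i <- r | P i) g (F i).
Proof.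
pose gL : {linear V -> W} := HB.pack g (GRing.isLinear.Build _ _ _ _ g gl).
exact: (linear_sum gL).
Qed.

Lemma star_hom_cp : completely_positive p.
Proof.
have [_ p_lin p_mul p_star] := p_hom.
move=> n G v; rewrite [leRHS](_ : _ = \sum_k `|\sum_j p (G k j) (v j)| ^+ 2).
  by apply: sumr_ge0 => k _; rewrite exprn_ge0.
under [RHS]eq_bigr => k _.
  rewrite ip_norm ip_sumr. over.
rewrite [RHS]exchange_big; apply: eq_bigr => i _ /=.
under [RHS]eq_bigr => k _ do rewrite ip_suml.
rewrite [RHS]exchange_big; apply: eq_bigr => j _ /=.
rewrite !mxE linear_sum_fun// bopE_sum ip_suml; apply: eq_bigr => k _.
by rewrite !mxE p_mul p_star bopE -adjPr.
Qed.

Variables (Y : topologicalType).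
Variables (iX : cfun R Y -> cfun R X) (iB : cfun R Y -> bop H).

(** The column V of the b_i is an isometry with p = V^* q V, where q is the
    direct sum of the q_i. As p is multiplicative, the Schwarz inequality for q
    forces |q f V x - V p f x| = 0, which is checked by summing over i. *)
Lemma star_hom_intertwines n (b : 'I_n -> bop H)
    (q : 'I_n -> cfun R X -> bop H) :
  proper_combination B iX iB b q p -> forall i f, q i f * b i = b i * p f.
Proof.
have [_ p_lin p_mul p_star] := p_hom.
move=> [q_ucp _ bb pE] i f; apply: bop_ext => x.
pose F i := `|q i f (b i x) - b i (p f x)| ^+ 2.
have F0 j : true -> 0 <= F j by move=> _; rewrite /F exprn_ge0.
(* Expanding the squares, three of the four sums equal |p f x| ^+ 2. *)
have sumF : \sum_j F j <= 0.
  have FE j : F j = `|q j f (b j x)| ^+ 2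
    - ip H ((adj (b j) * q j f * b j) x) (p f x)
    - ip H (p f x) ((adj (b j) * q j f * b j) x) +
      ip H ((adj (b j) * b j) (p f x)) (p f x).
    rewrite /F ip_norm !(ipBl, ipBr) !bopE -!adjPr -!adjP -!ip_norm; ring.
  rewrite (eq_bigr _ (fun j _ => FE j)) big_split !sumrB /=.
  have suml (T : 'I_n -> bop H) y z : \sum_j ip H (T j y) z =
    ip H ((\sum_j T j) y) z.
    by rewrite bopE_sum ip_suml.
  have sumr (T : 'I_n -> bop H) y z : \sum_j ip H z (T j y) =
    ip H z ((\sum_j T j) y).
    by rewrite bopE_sum ip_sumr.
  rewrite (suml (fun j => adj (b j) * q j f * b j))
    (sumr (fun j => adj (b j) * q j f * b j)).
  rewrite (suml (fun j => adj (b j) * b j)) bb -pE bopE -!ip_norm subrK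
    subr_le0.
  rewrite ip_norm adjPr -bopEM -p_star -p_mul pE bopE_sum ip_suml.
  apply: ler_sum => j _; have [_ q_lin q1 q_cp _] := q_ucp j.
  by rewrite !bopE -adjPr; exact: cp_schwarz.
have /(_ i isT) : forall j, true -> F j = 0.
  by apply: psumr_eq0P => //; apply/eqP; rewrite eq_le sumF sumr_ge0.
by move=> /eqP; rewrite sqrf_eq0 normr_eq0 subr_eq0 => /eqP.
Qed.

Hypotheses (vnB : von_neumann_algebra B) (iB_hom : star_hom B iB).
Hypothesis (iB1 : iB 1 = 1).
Hypotheses (iX1 : iX 1 = 1) (piX : forall c, p (iX c) = iB c).

Lemma star_hom_ucp : UCP B iX iB p.
Proof.
have [pB p_lin _ _] := p_hom.
by split=> //; [rewrite -iX1 piX|exact: star_hom_cp].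
Qed.

(** From q_i f * b_i = b_i * p f and its adjoint, b_i^* b_i commutes with every
    p f, hence so does the modulus of b_i. The unitary part of the polar
    decomposition of b_i therefore conjugates p into q_i. *)
Lemma star_hom_extreme : cstar_extreme B iX iB p.
Proof.
split=> [|n b q bqp]; first exact: star_hom_ucp.
have [_ _ _ p_star] := p_hom.
have qb := star_hom_intertwines bqp.
have [q_ucp b_inv _ _] := bqp.
suff /choice[u uP] : forall i, exists u, unitary_in (rel_commutant B iB) u /\
    forall f, q i f = adj u * p f * u by exists u.
move=> i; have [s [t [Ds Dt [s_adj t_adj] [st ts] [ss t_comm]]]] :=
  modulus_sqrt vnB iB_hom (b_inv i).
have [Db [c Dc [bc cb]]] := b_inv i.
have {}t_comm f : p f * t = t * p f.
  have [_ _ _ q_cp _] := q_ucp i.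
  apply: t_comm; rewrite -[RHS]mulrA -qb !mulrA; congr (_ * _).
  rewrite -[f]cfun_starK p_star (cp_star q_cp) -!adjointM.
  by rewrite qb.
have ttb : b i * t * (t * adj (b i)) = 1.
  have bE : b i = adj c * (s * s)
    by rewrite ss mulrA -adjointM bc adjoint1 mul1r.
  rewrite {1}bE -!mulrA (mulrA s t) st mul1r (mulrA s t) st mul1r.
  by rewrite -adjointM bc adjoint1.
exists (t * adj (b i)); split; first split.
- by apply: rel_commutantM => //; exact: rel_commutant_adj.
- by rewrite adjointM adjointK t_adj.
- by rewrite adjointM adjointK t_adj !mulrA -[t * _ * _]mulrA -ss mulrA ts mul1r
  st.
- move=> f; rewrite adjointM adjointK t_adj.
  by rewrite -[b i * t * p f]mulrA -t_comm [b i * (p f * t)]mulrA -qb -!mulrA [b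
    i * (t * _)]mulrA ttb mulr1.
Qed.

End StarHomExtreme.

(** * Square roots and bounds of continuous functions *)
Section ContinuousFunctionBounds.
Variables (R : realType) (X : topologicalType).
Implicit Types (f g h k : cfun R X).

(** The lower bound e makes the square root Lipschitz on the range of f, with
    constant 1 / sqrt e. *)
Lemma cfun_sqrt f (e : complex R) : 0 < e -> (forall x, e <= f x) ->
  exists2 k, cfun_star k = k & k * k = f.
Proof.
move=> e0 ef; have f0 x : 0 <= f x by rewrite (le_trans (ltW e0)).
have se0 : 0 < sqrtC e by rewrite sqrtC_gt0.
have kP : (fun x => sqrtC (f x)) \in @cfun_pred R X.
  have /asboolP fc := cfunP f.
  apply/asboolP => x; apply/cvgrPdist_lt => d d0.
  have /cvgrPdist_lt/(_ (d * sqrtC e) (mulr_gt0 d0 se0)) := fc x.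
  apply: filterS => y fxy; rewrite -(ltr_pM2r se0); apply: le_lt_trans fxy.
  have -> : f x - f y = (sqrtC (f x) - sqrtC (f y)) * (sqrtC (f x) +
    sqrtC (f y)).
    by rewrite -subr_sqr !sqrtCK.
  rewrite normrM ler_wpM2l// ger0_norm ?addr_ge0 ?sqrtC_ge0//.
  by rewrite (@le_trans _ _ (sqrtC (f x))) ?lerDl ?sqrtC_ge0//
    ler_sqrtC ?nnegrE ?(ltW e0).
exists (CFun kP); apply: cfun_ext => x.
  by rewrite cfunE /=; apply/CrealP/ger0_real; rewrite sqrtC_ge0.
by rewrite cfunE -expr2 sqrtCK.
Qed.

Lemma cfun_bounded f : compact [set: X] ->
  exists2 M : complex R, 0 < M & forall x, `|f x| <= M.
Proof.
move=> cptX; pose g x : R := complex.Re `|f x|.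
have fR x : `|f x| = (g x)%:C%C by rewrite /g RRe_real.
have gc : continuous g.
  have /asboolP fc := cfunP f.
  move=> x; apply/cvgrPdist_lt => d d0.
  have dC : 0 < d%:C%C :> complex R by rewrite (ltcR 0).
  have /cvgrPdist_lt/(_ _ dC) := fc x.
  apply: filterS => y fxy; rewrite -ltcR; apply: le_lt_trans fxy.
  have e : (g x - g y)%:C%C = `|f x| - `|f y| by rewrite rmorphB !fR.
  apply: le_trans (ler_dist_dist (f x) (f y)); rewrite -e;
    exact: (normc_ge_Re (g x - g y)%:C%C).
have /compact_bounded[M [_ MP]] : compact (g @` [set: X]).
  by apply: continuous_compact => //; exact: continuous_subspaceT.
exists (`|M| + 1)%:C%C => [|x]; first by rewrite (ltcR 0) ltr_wpDl.
rewrite fR lecR; apply: le_trans (ler_norm _) _.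
by apply: (MP (`|M| + 1));
  [rewrite (le_lt_trans (ler_norm _))// ltrDl|exists x].
Qed.

End ContinuousFunctionBounds.

(** * Faithfulness of the trace on positive operators *)
Section CenterValuedTrace.
Variables (R : realType) (H : hilbert R) (B : set (bop H)) (E : bop H -> bop H).
Hypotheses (vnB : von_neumann_algebra B) (trE : center_valued_trace B E).
Hypothesis (faithE : faithful_on B E).

Lemma positive_op_eq0 (T : bop H) :
  positive_op T -> positive_op (- T) -> T = 0.
Proof.
move=> T0 NT0; apply: bop_ext => x; apply: ip_ext => y; rewrite bopE ip0l.
apply: (@psd_form_eq0 _ _ (fun u v => ip H (T u) v)) => //.
- by move=> a u v w; rewrite bopDr bopZr ipPl.
- by move=> a u v w; rewrite ipPr.
- by apply/eqP; rewrite eq_le T0 -oppr_ge0 -ipNl andbT; exact: NT0.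
Qed.

(** Faithfulness concerns d^* d only. It is extended to a positive d by the
    bound d ^+ 2 <= k *: d, which gives E (d ^+ 2) <= k E d = 0. *)
Lemma positive_trace_eq0 (d : bop H) : B d -> positive_op d -> E d = 0 -> d = 0.
Proof.
have [_ BP BM _ _] := vnB; have [_ Elin Epos _ _] := trE.
move=> Bd d0 Ed0; have [k k0 dk] := bop_bounded d.
have d_adj := positive_op_adj d0.
have dd_pos : positive_op (d * d).
  by move=> x; rewrite -{1}d_adj ip_adj_norm exprn_ge0.
have ddk_pos : positive_op (k *: d - d * d).
  move=> x; rewrite !bopE ipBl ipZl subr_ge0 -{1}d_adj -adjPr -ip_norm.
  exact: positive_op_bounded.
have Bdd : B (d * d) by exact: BM.
have B0 : B 0 by rewrite -(subrr d) -scaleN1r addrC; exact: BP.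
have E0 : E 0 = 0 by have := Elin (-1) _ _ B0 B0;
  rewrite scaler0 addr0 scaleN1r addNr.
have BNdd : B (- (d * d)) by rewrite -[- _]addr0 -scaleN1r; exact: BP.
have ENdd : E (- (d * d)) = - E (d * d).
  by have := Elin (-1) _ _ Bdd B0; rewrite !addr0 !scaleN1r E0 addr0.
apply: faithE => //; rewrite d_adj; apply: positive_op_eq0; first exact: Epos.
rewrite -ENdd -[E (- _)]add0r -(scaler0 _ k) -Ed0 -Elin//.
by apply: Epos => //; exact: BP.
Qed.

End CenterValuedTrace.

(** * Extreme maps are homomorphisms *)
Section ExtremeStarHom.
Variables (R : realType) (X Y : topologicalType) (H : hilbert R)
  (B : set (bop H)).
Variables (iX : cfun R Y -> cfun R X) (iB : cfun R Y -> bop H).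
Hypotheses (vnB : von_neumann_algebra B) (iX_incl : unital_cfun_inclusion iX).
Hypothesis (iB_hom : star_hom B iB).
Local Notation D := (rel_commutant B iB).

Section Ucp.
Variable (p : cfun R X -> bop H).
Hypothesis (p_ucp : UCP B iX iB p).
Implicit Types (f g h k : cfun R X).

(** C(Y) lies in the multiplicative domain, as p is a homomorphism on it. *)
Lemma ucp_module f c : p (f * iX c) = p f * iB c.
Proof.
have [_ _ p1 p_cp piX] := p_ucp.
have [_ iX_mul iX_star _ _] := iX_incl; have [_ _ iB_mul iB_star] := iB_hom.
rewrite -piX; apply: multiplicative_domain => //.
by rewrite -iX_star -iX_mul !piX iB_mul iB_star.
Qed.

Lemma ucp_rel_commutant f : D (p f).
Proof.
have [pB _ _ p_cp _] := p_ucp; have [_ _ iX_star _ _] := iX_incl.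
have [_ _ _ iB_star] := iB_hom.
apply/rel_commutantP; split=> // c;
  rewrite -ucp_module -[LHS]adjointK -(cp_star p_cp).
by rewrite cfun_starM -iX_star ucp_module adjointM (cp_star p_cp) iB_star
  !adjointK.
Qed.

Lemma ucp_positive f (e : complex R) : 0 < e -> (forall x, e <= f x) ->
  positive_op (p f).
Proof.
have [_ _ p1 p_cp _] := p_ucp.
move=> e0 ef x; have [k k_star <-] := cfun_sqrt e0 ef.
by rewrite -{1}k_star; apply: le_trans (cp_schwarz p1 p_cp k x);
  rewrite exprn_ge0.
Qed.

(** Up to the factors t = s ^-1, this is the summand g |-> p (k^* g k) of p.
    It fixes C(Y) because s and t commute with the image of C(Y). *)
Lemma ucp_compression k s t : cfun_star k = k -> s * s = p (k * k) ->
  D t -> adj t = t -> s * t = 1 -> t * s = 1 ->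
  UCP B iX iB (fun g => t * p (k * k * g) * t).
Proof.
have [pB p_lin p1 p_cp _] := p_ucp; have [_ _ BM _ _] := vnB.
move=> k_star ss /rel_commutantP[Bt tc] t_adj st ts.
have ttk : t * p (k * k) * t = 1 by rewrite -ss mulrA ts mul1r st.
split=> [f|a f g||n G v|c].
- exact: BM _ _ (BM _ _ Bt (pB _)) Bt.
- by rewrite mulrDr cfun_scaleAr p_lin mulrDr mulrDl bop_scaleAr bop_scaleAl.
- by rewrite mulr1.
- have := p_cp n (\matrix_(i, j) (k * G i j)) (fun i => t (v i)).
  rewrite (eq_bigr (fun i => \sum_j ip H
    (map_mx (fun g => t * p (k * k * g) * t) (map_mx (@cfun_star R X) G^T *m G)
      i j (v j))
    (v i)))// => i _; apply: eq_bigr => j _.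
  rewrite !mxE !bopE [RHS]adjP t_adj; congr (ip H (p _ _) _).
  rewrite mulr_sumr; apply: eq_bigr => l _; rewrite !mxE cfun_starM k_star.
  by rewrite mulrACA.
- by rewrite ucp_module mulrA -[_ * iB c * t]mulrA -tc mulrA ttk mul1r.
Qed.

Lemma multiplicative_lin a f g :
  (forall h, p (h * f) = p h * p f) -> (forall h, p (h * g) = p h * p g) ->
  forall h, p (h * (a *: f + g)) = p h * p (a *: f + g).
Proof.
have [_ p_lin _ _ _] := p_ucp.
by move=> pf pg h; rewrite mulrDr cfun_scaleAr !p_lin mulrDr bop_scaleAr pf pg.
Qed.

End Ucp.

Variable (E : bop H -> bop H).
Hypotheses (trE : center_valued_trace B E) (faithE : faithful_on B E).

(** The only use of finiteness: T and u^* T u have the same trace, so a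
    positive difference must vanish. *)
Lemma unitary_conj_ge T u : B T -> unitary_in D u ->
  positive_op (adj u * T * u - T) -> adj u * T * u = T.
Proof.
have [_ BP BM BV _] := vnB; have [_ Elin _ _ Etr] := trE.
move=> BT [[Bu _] uu uu'] h; apply/eqP; rewrite -subr_eq0; apply/eqP.
have BuTu : B (adj u * T * u) by exact: BM _ _ (BM _ _ (BV _ Bu) BT) Bu.
have BTu : B (T * u) by exact: BM.
have -> : adj u * T * u - T = -1 *: T + adj u * T * u by rewrite addrC scaleN1r.
apply: (positive_trace_eq0 vnB trE faithE).
- exact: BP.
- by rewrite addrC scaleN1r.
- rewrite Elin// -mulrA Etr//; last exact: BV.
  by rewrite -mulrA uu' mulr1 scaleN1r addNr.
Qed.

Variable (p : cfun R X -> bop H).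
Hypothesis (p_ext : cstar_extreme B iX iB p).
Let p_ucp : UCP B iX iB p. Proof. by have [] := p_ext. Qed.

(** Write p g = p (f g) + p ((1 - f) g), a proper combination with coefficients
    s = (p f)^(1/2) and s' = (p (1 - f))^(1/2). Extremality gives a unitary u
    with p (f g) = s u^* p g u s for all g. At g = f, the Schwarz inequality
    reads u^* T u >= T for T = p f; by finiteness this is an equality, and
    p (f ^+ 2) = s T s = T ^+ 2. *)
Lemma extreme_square (f : cfun R X) :
  (forall x, 3 / 8 <= f x) -> (forall x, f x <= 5 / 8) ->
  p (f * f) = p f * p f.
Proof.
have [pB p_lin p1 p_cp piX] := p_ucp.
move=> f_ge f_le.
have q0 n m : 0 < n.+1%:R / m.+1%:R :> complex R by rewrite divr_gt0 ?ltr0n.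
have f_star : cfun_star f = f.
  by apply: cfun_ext => x; rewrite cfunE;
    apply/CrealP/ger0_real/(le_trans _ (f_ge x))/ltW/q0.
have f'_ge x : 3 / 8 <= (1 - f) x.
  rewrite cfunED cfunEN cfunE1 lerBrDr -lerBrDl; apply: le_trans (f_le x) _.
  by rewrite (_ : 1 - 3 / 8 = 5 / 8 :> complex R)//; field.
have [k k_star kk] := cfun_sqrt (q0 2 7) f_ge.
have [k' k'_star kk'] := cfun_sqrt (q0 2 7) f'_ge.
have T'E : p (1 - f) = 1 - p f
  by rewrite addrC -scaleN1r p_lin p1 scaleN1r addrC.
(* Room between 1/4 and 3/8 keeps g - 1/4 bounded away from 0, so that its
   square root is continuous and p (g - 1/4) is positive. *)
have shift (g : cfun R X) : (forall x, 3 / 8 <= g x) ->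
    positive_op (p g - 4^-1 *: (1 : bop H)).
  move=> g_ge; have -> : p g - 4^-1 *: (1 : bop H) =
    p (- 4^-1 *: (1 : cfun R X) + g).
    by rewrite p_lin p1 scaleNr addrC.
  apply: (ucp_positive p_ucp (q0 0 7)) => x; rewrite !cfunE mulr1.
  rewrite -lerBlDl opprK (le_trans _ (g_ge x))//.
  by rewrite le_eqVlt (_ : 1 / 8 + 4^-1 = 3 / 8 :> complex R) ?eqxx//; field.
have half (g h : cfun R X) : (forall x, 3 / 8 <= g x) ->
    (forall x, 3 / 8 <= h x) -> p g = 1 - p h -> bounded_by (3 / 4) (p g).
  move=> g_ge h_ge gh;
  apply: (order_bounded (ucp_positive p_ucp (q0 2 7) g_ge)).
  rewrite gh opprB addrA (_ : _ *: (1 : bop H) + p h - 1 =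
    p h - 4^-1 *: (1 : bop H)); first exact: shift.
  rewrite addrAC addrC; congr (_ + _);
    rewrite -[X in _ - X]scale1r -scalerBl -scaleNr.
  by congr (_ *: _); field.
have r1 : 3 / 4 < 1 :> complex R by rewrite ltr_pdivrMr// mul1r ltr_nat.
have adj_p g : cfun_star g = g -> adj (p g) = p g by move=> gs;
  rewrite -(cp_star p_cp) gs.
have [||s [t [Ds Dt [s_adj t_adj] [st ts] [ss _]]]] :=
    rel_commutant_sqrt vnB (ltW (q0 2 3)) r1 (ucp_rel_commutant p_ucp f).
- exact: adj_p.
- by rewrite -T'E; apply: (half _ f) => //.
have [||s' [t' [Ds' Dt' [s'_adj t'_adj] [st' ts'] [ss' _]]]] :=
    rel_commutant_sqrt vnB (ltW (q0 2 3)) r1 (ucp_rel_commutant p_ucp (1 - f)).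
- by rewrite T'E adjointB adjoint1 adj_p.
- by rewrite T'E opprB addrC subrK; apply: (half _ (1 - f)) => //;
  rewrite T'E opprB addrC subrK.
have [_ /(_ 2 (fun i => if i == ord0 then s else s')
  (fun i g => if i == ord0 then t * p (k * k * g) * t else t' * p (k' * k' * g)
    * t'))] := p_ext.
case=> [|us /(_ ord0) /= [u_unitary uE]]; last first.
  set u := us ord0 in u_unitary uE.
  have {uE} pff : p (f * f) = s * (adj u * p f * u) * s.
    by rewrite -uE kk !mulrA st mul1r -mulrA ts mulr1.
  have Tu : adj u * p f * u = p f.
    apply: unitary_conj_ge => // y; rewrite bopEB ipBl subr_ge0.
    have sty : s (t y) = y by rewrite -bopEM st.
    have ssE : p f (t y) = s y by rewrite -ss bopEM sty.
    have := cp_schwarz p1 p_cp f (t y).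
    rewrite f_star pff ssE (bopEM _ s) (bopEM s) sty [leRHS](adjP s) s_adj sty;
      apply: le_trans.
    by rewrite -ss bopEM adjP s_adj ip_norm.
  by rewrite pff Tu -ss !mulrA.
split.
- move=> i /=; case: (i == ord0).
    by apply: (ucp_compression p_ucp (s := s)); rewrite ?kk.
  by apply: (ucp_compression p_ucp (s := s')); rewrite ?kk'.
- by move=> i; case: (i == ord0); split=> //; [exists t|exists t'].
- by rewrite !big_ord_recl big_ord0 /= addr0 s_adj s'_adj ss ss' T'E addrC
  subrK.
- move=> g; rewrite !big_ord_recl big_ord0 /= addr0 s_adj s'_adj kk kk'.
  rewrite !mulrA st st' !mul1r -!mulrA ts ts' !mulr1 -[p (f * g)]scale1r -p_lin
    scale1r.
  by rewrite -mulrDl addrC subrK mul1r.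
Qed.

(** Every self-adjoint h is an affine function of some f with values between
    3/8 and 5/8, so by [extreme_square] it lies in the multiplicative domain;
    the latter is a linear subspace, hence it is all of C(X). *)
Lemma extreme_star_hom : compact [set: X] -> star_hom B p.
Proof.
move=> cptX; have [pB p_lin p1 p_cp piX] := p_ucp.
have p0 : p 0 = 0 by have := p_lin (-1) 0 0;
  rewrite scaler0 addr0 scaleN1r addNr.
have p_mul0 f : p (f * 0) = p f * p 0 by rewrite p0 !mulr0 p0.
have p_mul1 f : p (f * 1) = p f * p 1 by rewrite p1 !mulr1.
have p_mul_sa h : cfun_star h = h -> forall g, p (g * h) = p g * p h.
  move=> h_star; have [M M0 hM] := cfun_bounded h cptX.
  have hR x : h x \is Num.real by apply/CrealP; rewrite -[in RHS]h_star cfunE.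
  pose f := (8 * M)^-1 *: h + 2^-1 *: (1 : cfun R X).
  have M8 : 0 < (8 * M)^-1 by rewrite invr_gt0 mulr_gt0.
  have hb x : - 8^-1 <= (8 * M)^-1 * h x <= 8^-1.
    rewrite -real_ler_norml; last by rewrite rpredM// gtr0_real.
    rewrite normrM gtr0_norm// mulrC ler_pdivrMr ?mulr_gt0//.
    by rewrite mulKf ?pnatr_eq0.
  have f_star : cfun_star f = f.
    have cR (c : complex R) : 0 < c -> c^* = c by move=> c0;
      apply/CrealP/gtr0_real.
    by rewrite cfun_starD !cfun_starZ h_star cfun_star1 (cR _ M8) cR// invr_gt0.
  have ff : p (f * f) = p f * p f.
    apply: extreme_square => x; rewrite !cfunE mulr1;
      have /andP[hb1 hb2] := hb x.
      by rewrite (_ : 3 / 8 = - 8^-1 + 2^-1) ?lerD2r//; field.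
    by rewrite (_ : 5 / 8 = 8^-1 + 2^-1) ?lerD2r//; field.
  have pf : forall g, p (g * f) = p g * p f.
    by apply: (multiplicative_domain p1 p_cp); rewrite -(cp_star p_cp) f_star.
  have -> : h = (8 * M) *: f + (- (4 * M) *: (1 : cfun R X) + 0).
    rewrite scalerDr !scalerA mulfV ?scale1r -?addrA;
      last by rewrite gt_eqF// -invr_gt0.
    by rewrite addr0 -scalerDl (_ : 8 * M / 2 + - (4 * M) = 0)
      ?scale0r ?addr0//; field.
  by do 2!apply: (multiplicative_lin p_ucp) => //.
split=> //; last exact: cp_star.
move=> g h; have -> : h = 2^-1 *: (h + cfun_star h) +
    ((- ('i / 2)) *: ('i *: (h + -1 *: cfun_star h)) + 0).
  rewrite addr0 scalerA mulNr mulrAC -expr2 sqrCi mulN1r opprK -scalerDr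
    scaleN1r.
  by rewrite addrACA subrr addr0 -[h + h]mulr2n
    -[h *+ 2]scaler_nat scalerA mulVf ?scale1r ?pnatr_eq0.
move: g; apply: (multiplicative_lin p_ucp);
  last apply: (multiplicative_lin p_ucp) => //.
  by apply: p_mul_sa; rewrite cfun_starD cfun_starK addrC.
apply: p_mul_sa; rewrite !(cfun_starD, cfun_starZ) cfun_starK rmorphN1 conjCi.
by rewrite scaleNr -scalerN !scaleN1r opprD opprK addrC.
Qed.

End ExtremeStarHom.

Theorem theorem1p1 (R : realType) (X Y : topologicalType)
  (cptX : compact [set: X]) (hausX : hausdorff_space X)
  (cptY : compact [set: Y]) (hausY : hausdorff_space Y)
  (H : hilbert R) (B : set (bop H))
  (vnB : von_neumann_algebra B) (finB : finite_vna B)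
  (iX : cfun R Y -> cfun R X) (iX_incl : unital_cfun_inclusion iX)
  (iB : cfun R Y -> bop H) (iB_incl : unital_inclusion B iB) :
  cstar_extreme B iX iB =
  [set p : cfun R X -> bop H | star_hom B p /\ forall c, p (iX c) = iB c].
Proof.
have [iB_hom iB1 _] := iB_incl; have [_ _ _ iX1 _] := iX_incl.
have [E [trE _ faithE]] := finB.
apply/seteqP; split=> [p p_ext|p [p_hom piX]].
  split; first exact: extreme_star_hom iB_hom E trE faithE p p_ext cptX.
  by have [[]] := p_ext.
exact: star_hom_extreme.
Qed.
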